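(* Let $d\geq 2$ and let $p_c$ be the critical probability of the site percolation model on $\mathbb{Z}^d$. Then $$\limsup_{n\to\infty}\ \frac{1}{\ln n}\,\ln P_{p_c}\bigl(\text{two-arms}(0,n)\bigr)\ \leq\ -\frac{2d^2+3d-3}{4d^2+5d-5}.$$
   Context: Site percolation on $\mathbb{Z}^d$ with parameter $p$: each site is declared open with probability $p$ and closed with probability $1-p$, independently; $P_p$ is the corresponding probability. Two sites $x,y$ are neighbors if $|x-y|=1$ (nearest neighbors, Euclidean distance). $\theta(p)$ is the $P_p$-probability that the origin belongs to an infinite open cluster, and $p_c=\sup\{p:\theta(p)=0\}$. For $n\in\mathbb{N}$, $\Lambda(n)=[-n,n]^d$ (as a subset of $\mathbb{Z}^d$). The internal boundary of $A\subset\mathbb{Z}^d$ is $\partial^{\mathrm{in}}A=\{x\in A:\exists y\in A^c,\ |x-y|=1\}$. The open clusters of the configuration restricted to a box are the connected components of the graph whose vertices are the open sites of the box and whose edges join nearest neighbors. For $x\in\mathbb{Z}^d$ and $n\geq 1$, $\text{two-arms}(x,n)$ is the event that, in the configuration restricted to $x+\Lambda(n)$, two neighbors of $x$ are connected to the (internal) boundary of the box $x+\Lambda(n)$ by two disjoint open clusters (i.e. two neighbors of $x$ belong to two distinct open clusters of the configuration restricted to $x+\Lambda(n)$, both of which intersect $\partial^{\mathrm{in}}(x+\Lambda(n))$). *)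

(* Defs.v *)
From mathcomp Require Import all_boot all_order all_algebra.
From mathcomp Require Import all_classical all_reals all_analysis.

Set Implicit Arguments.
Unset Strict Implicit.
Unset Printing Implicit Defensive.

Import Order.TTheory GRing.Theory Num.Theory.
Local Open Scope classical_set_scope.
Local Open Scope ring_scope.

Definition site (d : nat) := 'rV[int]_d.

Definition configuration (d : nat) := site d -> bool.

(* The product sigma-algebra on {0,1}^(Z^d). *)
Definition coordinate_events (d : nat) : set (set (configuration d)) :=
  [set [set w : configuration d | w x] | x in [set: site d]].

Definition configurations (d : nat) :=
  g_sigma_algebraType (coordinate_events (d := d)).

(* P p is the product of Bernoulli(p) measures (true = open, false = closed).
   This is expressed by the finite-dimensional distributions, which determine
   the measure on the product sigma-algebra. *)
Definition site_percolation (R : realType) (d : nat)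
    (P : R -> probability (configurations d) R) :=
  forall p : R, 0 <= p <= 1 ->
  forall (s : seq (site d)) (v : configuration d), uniq s ->
    P p [set w : configuration d | {in s, w =1 v}] =
    (\prod_(x <- s) bernoulli_pmf p (v x))%:E.

Definition euclidean_norm (R : realType) (d : nat) (x : site d) : R :=
  Num.sqrt (\sum_(i < d) (x ord0 i)%:~R ^+ 2).

Definition neighbor (R : realType) (d : nat) : rel (site d) :=
  fun x y => euclidean_norm R (x - y) == 1.

Definition Lambda (d n : nat) : set (site d) :=
  [set y : site d | forall i : 'I_d, - n%:Z <= y ord0 i <= n%:Z].

Definition box (d : nat) (x : site d) (n : nat) : set (site d) :=
  [set x + y | y in Lambda (d := d) n].

Definition inner_boundary (R : realType) (d : nat) (A : set (site d)) :
    set (site d) :=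
  [set x : site d | A x /\ exists y, ~ A y /\ neighbor R x y].

Definition open_in (d : nat) (w : configuration d) (A : set (site d)) :
    set (site d) :=
  [set x : site d | A x /\ w x].

Definition connected_in (R : realType) (d : nat) (w : configuration d)
    (A : set (site d)) (x y : site d) : Prop :=
  exists s : seq (site d),
    [/\ path (@neighbor R d) x s, last x s = y
      & forall z, z \in x :: s -> open_in w A z].

(* This is empty when x is closed or outside A. *)
Definition cluster (R : realType) (d : nat) (w : configuration d)
    (A : set (site d)) (x : site d) : set (site d) :=
  [set y : site d | connected_in R w A x y].

Definition open_clusters (R : realType) (d : nat) (w : configuration d)
    (A : set (site d)) : set (set (site d)) :=
  [set cluster R w A x | x in open_in w A].

Definition theta (R : realType) (d : nat)
    (P : R -> probability (configurations d) R) (p : R) : \bar R :=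
  P p [set w : configuration d | infinite_set (cluster R w setT 0)].

Definition critical_probability (R : realType) (d : nat)
    (P : R -> probability (configurations d) R) : R :=
  sup [set p : R | 0 <= p <= 1 /\ theta P p = 0%E].

Definition two_arms (R : realType) (d : nat) (x : site d) (n : nat) :
    set (configuration d) :=
  [set w : configuration d | exists y z : site d, exists C D : set (site d),
    [/\ neighbor R x y /\ neighbor R x z,
        open_clusters R w (box x n) C /\ open_clusters R w (box x n) D,
        C <> D,
        C y /\ D z
      & C `&` inner_boundary R (box x n) !=set0 /\
        D `&` inner_boundary R (box x n) !=set0]].

(* Main.v *)
Require Import Defs.
From mathcomp Require Import all_boot all_order all_algebra.
From mathcomp Require Import all_classical all_reals all_analysis.
From mathcomp Require Import perm.
From mathcomp Require Import ring lra zify.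
Import Order.TTheory GRing.Theory Num.Theory.
Import numFieldNormedType.Exports.
Local Open Scope classical_set_scope.
Local Open Scope ring_scope.
Set Implicit Arguments.
Unset Strict Implicit.
Unset Printing Implicit Defensive.

(** Write [alpha n] for the critical probability of two arms of length [n]. The
    endpoints 0 and 1 are trivial, so let [0 < p < 1] be the critical point.

    The first ingredient is an inequality of Aizenman, Kesten and Newman. Call a
    cluster of [Lambda(4 N)] crossing if it touches the boundary and meets
    [Lambda(2 N)]. A site of [Lambda(N)] with two arms of length [8 N] is closed
    and adjacent to two different crossing clusters. Give to every site [y] the
    score [p - w y] and sum the scores in [Lambda(N)] of the sites seen by an
    exploration of the crossing clusters. If each site is counted once, the sum
    is centered; if each cluster contributes the sites that it sees, the closed
    sites between two clusters are counted twice, so the expected number of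
    sites with two arms is bounded by the expected sum of the scores of the
    single clusters. The score of one cluster is, up to a constant factor and to
    first order in [delta], the logarithm of a likelihood ratio between the
    densities [p - delta] and [p], divided by [delta]. Likelihood ratios have
    mean one ([Ex_stopping_prod]), and this gives ([AKN])

      alpha(8 N) <= C (E(number of crossing clusters) log(N) / (delta N^d) + delta).

    Bounding the number of clusters by [N^(d-1)] would yield the exponent 1/2.

    The second ingredient bounds this number. Cover the boundary of
    [Lambda(2 N)] by [C (N/n)^(d-1)] boxes of radius [n]. Two crossing clusters
    rarely meet the same small box ([Pr_separated]): resampling the box of
    twice the radius almost never changes the way in which the arms are joined,
    because a change reveals a site with two arms; on the other hand, given the
    two clusters, with probability at least [c n^(- 2 d (d-1))] the new
    configuration joins them ([Pr_connected_box]). This last lower bound is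
    special to the critical point. There the expected size of the cluster of the
    origin on the boundary of a box cannot be small ([critical_Phi]), because
    otherwise the same would hold for a slightly larger density, and an arm
    would decay exponentially. Some boundary site of each box is therefore
    connected to the centre with polynomial probability; reflections and the
    Harris inequality then connect any two sites of a box.

    Altogether the expected number of crossing clusters is at most
    [C (N/n)^(d-1) (1 + n^(2 d^2 + d) alpha(N))] ([Ex_crossing_poly]), and the
    two ingredients combine into [alpha_recursion]. If [alpha(N) <= C N^(-g)], the
    choice [n = N^(g/D)] with [D = 2 d^2 + 3 d - 3] improves the exponent [g] to
    any exponent below [(1 + g (d-1)/D) / 2]. Iterating this affine contraction
    from [g = 0] leads to every exponent below its fixed point
    [D / (2 D - (d-1))], which is the exponent of the theorem. *)

(** * Iterated expectations over finitely many coordinates *)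

Section Expectation.
Variables (R : realType) (T : eqType).
Implicit Types (p : T -> R) (s : seq T) (w : T -> bool) (F G : (T -> bool) -> R).

Definition upd w x b : T -> bool := fun y => if y == x then b else w y.

(** The coordinates in [s] are resampled, all the others keep the value they
    have in [w]: this is at the same time an expectation and, as a function of
    [w], a conditional expectation given the coordinates outside [s]. *)
Fixpoint Ex p s F w : R :=
  if s is x :: s' then
    p x * Ex p s' F (upd w x true) + (1 - p x) * Ex p s' F (upd w x false)
  else F w.

Definition is_prob p := forall x, 0 <= p x <= 1.

Definition depends_on (U : Type) (D : T -> Prop) (f : (T -> bool) -> U) :=
  forall w w', (forall x, D x -> w x = w' x) -> f w = f w'.

Definition le_conf w w' := forall x, w x -> w' x.

Definition increasing F := forall w w', le_conf w w' -> F w <= F w'.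

Lemma upd_same w x b : upd w x b x = b.
Proof. by rewrite /upd eqxx. Qed.

Lemma upd_other w x b y : y != x -> upd w x b y = w y.
Proof. by rewrite /upd => /negbTE ->. Qed.

Lemma updC w x y b c : x != y -> upd (upd w x b) y c = upd (upd w y c) x b.
Proof.
move=> xy; apply/funext => z; rewrite /upd.
by case: (eqVneq z y) => // ->; rewrite eq_sym (negbTE xy).
Qed.

Lemma eq_Ex p s F G w : F =1 G -> Ex p s F w = Ex p s G w.
Proof. by move=> /funext ->. Qed.

Lemma Ex_const p s c w : Ex p s (fun=> c) w = c.
Proof. by elim: s w => //= x s IH w; rewrite !IH; ring. Qed.

Lemma ExD p s F G w :
  Ex p s (fun w => F w + G w) w = Ex p s F w + Ex p s G w.
Proof. by elim: s w => //= x s IH w; rewrite !IH; ring. Qed.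

Lemma ExZ p s c F w : Ex p s (fun w => c * F w) w = c * Ex p s F w.
Proof. by elim: s w => //= x s IH w; rewrite !IH; ring. Qed.

Lemma Ex_sum (I : Type) (r : seq I) (Q : pred I) p s (F : I -> (T -> bool) -> R) w :
  Ex p s (fun w => \sum_(i <- r | Q i) F i w) w = \sum_(i <- r | Q i) Ex p s (F i) w.
Proof.
elim: r => [|i r IH].
  under eq_Ex do rewrite big_nil.
  by rewrite big_nil Ex_const.
under eq_Ex do rewrite big_cons.
rewrite big_cons; case: (Q i) => //.
by rewrite ExD IH.
Qed.

Lemma le_Ex p s F G w :
  is_prob p -> (forall w, F w <= G w) -> Ex p s F w <= Ex p s G w.
Proof.
move=> hp FG; elim: s w => //= x s IH w.
have /andP[p0 p1] := hp x.
by apply: lerD; apply: ler_wpM2l; rewrite ?subr_ge0.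
Qed.

Lemma Ex_ge0 p s F w : is_prob p -> (forall w, 0 <= F w) -> 0 <= Ex p s F w.
Proof. by move=> hp F0; rewrite -(Ex_const p s 0 w); apply: le_Ex. Qed.

Lemma Ex_cat p s1 s2 F w : Ex p (s1 ++ s2) F w = Ex p s1 (Ex p s2 F) w.
Proof. by elim: s1 w => //= x s1 IH w; rewrite !IH. Qed.

Lemma Ex_swap p x y s F w : Ex p (x :: y :: s) F w = Ex p (y :: x :: s) F w.
Proof.
have [->//|xy] := eqVneq x y; rewrite /=.
by rewrite !(updC _ _ _ xy); ring.
Qed.

Lemma Ex_perm p s1 s2 F w : perm_eq s1 s2 -> Ex p s1 F w = Ex p s2 F w.
Proof.
elim: s1 s2 w => [|x s1 IH] s2 w.
  by move=> /perm_size /esym /size0nil ->.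
move=> ps; have xs2 : x \in s2 by rewrite -(perm_mem ps) mem_head.
have [i t ht] := rot_to xs2.
have -> : Ex p s2 F w = Ex p (x :: rem x s2) F w.
  elim: {IH ps i t ht} s2 xs2 w => // y s2 IH.
  rewrite inE => /orP[/eqP <- w|xs2 w]; first by rewrite /= eqxx.
  have [->|yx] := eqVneq y x; first by rewrite /= eqxx.
  have -> : rem x (y :: s2) = y :: rem x s2 by rewrite /= (negbTE yx).
  by rewrite Ex_swap /= !(IH xs2) /=.
have pt : perm_eq s1 (rem x s2).
  by rewrite -(perm_cons x) (perm_trans ps)// perm_to_rem.
by rewrite /= !(IH _ _ pt).
Qed.

Lemma depends_on_sub (U : Type) (D D' : T -> Prop) (f : (T -> bool) -> U) :
  (forall x, D x -> D' x) -> depends_on D f -> depends_on D' f.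
Proof. by move=> DD' hf w w' ww'; apply: hf => x /DD'; exact: ww'. Qed.

Lemma Ex_eq_outside D p s F w w' : depends_on D F ->
  (forall x, x \notin s -> D x -> w x = w' x) -> Ex p s F w = Ex p s F w'.
Proof.
move=> hF; elim: s w w' => [|x s IH] w w' ww' /=.
  by apply: hF => x Dx; exact: ww'.
by congr (_ * _ + _ * _); apply: IH => y ys Dy; rewrite /upd;
  case: eqVneq => // yx; apply: ww' => //; rewrite inE negb_or yx.
Qed.

Lemma ExM_free p s F G w : depends_on (fun x => x \notin s) F ->
  Ex p s (fun w => F w * G w) w = F w * Ex p s G w.
Proof.
elim: s w => //= x s IH w hF.
have hF' : depends_on (fun x => x \notin s) F.
  by apply: depends_on_sub hF => y; rewrite inE negb_or => /andP[].
rewrite !IH//.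
have e b : F (upd w x b) = F w.
  by apply: hF => y; rewrite inE negb_or => /andP[yx _]; rewrite upd_other.
by rewrite !e; ring.
Qed.

Lemma Ex_free p s F w : depends_on (fun x => x \notin s) F -> Ex p s F w = F w.
Proof.
move=> hF; rewrite -[RHS]mulr1 -(Ex_const p s 1 w) -ExM_free//.
by apply: eq_Ex => w'; rewrite mulr1.
Qed.

Lemma Ex_indep p s1 s2 F G w :
  depends_on (fun x => x \notin s2) F -> depends_on (fun x => x \notin s1) G ->
  Ex p (s1 ++ s2) (fun w => F w * G w) w = Ex p s1 F w * Ex p s2 G w.
Proof.
move=> hF hG; rewrite Ex_cat.
under eq_Ex do rewrite ExM_free// mulrC.
rewrite ExM_free 1?mulrC// => u u' uu'.
by apply: (Ex_eq_outside _ hG) => x _; exact: uu'.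
Qed.

Lemma perm_cat_filter_notin s S : uniq s -> uniq S -> {subset s <= S} ->
  perm_eq S ([seq x <- S | x \notin s] ++ s).
Proof.
move=> us uS sS; apply: uniq_perm => //.
  rewrite cat_uniq filter_uniq// us andbT /= -all_predC.
  by apply/allP => x xs /=; rewrite mem_filter xs.
move=> x; rewrite mem_cat mem_filter.
by case: (boolP (x \in s)) => [/sS->|]; rewrite ?andbT ?orbT ?orbF.
Qed.

(** Tower property: first average over [s] with everything else frozen. *)
Lemma Ex_tower p s S F w : uniq s -> uniq S -> {subset s <= S} ->
  Ex p S F w = Ex p [seq x <- S | x \notin s] (Ex p s F) w.
Proof.
by move=> us uS sS; rewrite -Ex_cat; exact/Ex_perm/perm_cat_filter_notin.
Qed.

Lemma Ex_marginal p s S F w w' : uniq s -> uniq S -> {subset s <= S} ->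
  depends_on (fun x => x \in s) F -> Ex p S F w = Ex p s F w'.
Proof.
move=> us uS sS hF; rewrite (Ex_tower _ _ _ us uS sS) Ex_free.
  by apply: (Ex_eq_outside _ hF) => x /negP.
by move=> u u' _; apply: (Ex_eq_outside _ hF) => x /negP.
Qed.

Lemma Ex_increasing p s F : is_prob p -> increasing F -> increasing (Ex p s F).
Proof.
move=> hp iF; elim: s => //= x s IH w w' ww'.
have /andP[p0 p1] := hp x.
by apply: lerD; apply: ler_wpM2l; rewrite ?subr_ge0//; apply: IH => y;
  rewrite /upd; case: eqVneq => // _; exact: ww'.
Qed.

(** Harris inequality (FKG for product measures): one coordinate at a time it
    reduces to the two-point inequality
    [p a b + q c d >= (p a + q c)(p b + q d)] for [a >= c] and [b >= d]. *)
Lemma Harris p s F G w : is_prob p -> increasing F -> increasing G ->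
  Ex p s F w * Ex p s G w <= Ex p s (fun w => F w * G w) w.
Proof.
move=> hp iF iG; elim: s w => //= x s IH w.
have /andP[p0 p1] := hp x.
have le01 : le_conf (upd w x false) (upd w x true).
  by move=> y; rewrite /upd; case: eqVneq.
have hF := Ex_increasing s hp iF le01.
have hG := Ex_increasing s hp iG le01.
apply: (@le_trans _ _ (p x * (Ex p s F (upd w x true) * Ex p s G (upd w x true))
  + (1 - p x) * (Ex p s F (upd w x false) * Ex p s G (upd w x false)))); last first.
  by apply: lerD; apply: ler_wpM2l; rewrite ?subr_ge0.
move: hF hG (IH (upd w x true)); set a := Ex p s F _; set b := Ex p s F _.
set c := Ex p s G _; set e := Ex p s G _ => ab ce _.
rewrite -subr_ge0 [X in 0 <= X](_ : _ = p x * (1 - p x) * ((b - a) * (e - c))).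
  by rewrite mulr_ge0// mulr_ge0// subr_ge0.
by ring.
Qed.


Lemma Ex_upd p s F w x b : x \notin s ->
  Ex p s F (upd w x b) = Ex p s (fun u => F (upd u x b)) w.
Proof.
elim: s w => //= y s IH w; rewrite inE negb_or => /andP[xy xs].
by rewrite !(updC _ _ _ xy) !IH.
Qed.

(** An observable [f] that rarely reacts to a single flip is almost constant.
    Along the recursion over [s], keep the candidate value of the half whose
    total flip probability is the smaller one. *)
Lemma almost_constant (U : Type) (f : (T -> bool) -> U) p s w :
  is_prob p -> uniq s ->
  exists c : U,
    Ex p s (fun w => `[< f w <> c >]%:R) w <=
    \sum_(z <- s) Ex p s (fun w => `[< f (upd w z true) <> f (upd w z false) >]%:R) w.
Proof.
move=> hp; elim: s w => [|x s IH] w /=.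
  by exists (f w); rewrite big_nil /= asboolF.
move=> /andP[xs us]; have /andP[p0 p1] := hp x.
have q0 : 0 <= 1 - p x by rewrite subr_ge0.
pose piv z w : R := `[< f (upd w z true) <> f (upd w z false) >]%:R.
have piv0 z u : 0 <= piv z u by rewrite ler0n.
pose t b := \sum_(z <- s) Ex p s (piv z) (upd w x b).
pose h := Ex p s (piv x) w.
have hE b : Ex p s (piv x) (upd w x b) = h.
  rewrite Ex_upd//; apply: eq_Ex => u; rewrite /piv.
  have e c : upd (upd u x b) x c = upd u x c.
    by apply/funext => y; rewrite /upd; case: eqVneq.
  by rewrite !e.
have h0 : 0 <= h by exact: Ex_ge0.
rewrite big_cons /= -/(piv x) !hE.
have -> : p x * h + (1 - p x) * h = h by ring.
have -> : \sum_(z <- s) (p x * Ex p s (piv z) (upd w x true) +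
    (1 - p x) * Ex p s (piv z) (upd w x false)) = p x * t true + (1 - p x) * t false.
  by rewrite big_split /= -!mulr_sumr.
have step b b' (c : U) : Ex p s (fun w => `[< f w <> c >]%:R) (upd w x b) <= t b ->
    Ex p s (fun w => `[< f w <> c >]%:R) (upd w x b') <=
      t b + (b != b')%:R * h.
  have [<-|bb'] := eqVneq b b'; first by rewrite mul0r addr0.
  rewrite mul1r -(lerD2r h); apply: le_trans.
  rewrite !Ex_upd// -ExD; apply: le_Ex => // u.
  rewrite /piv; case: asboolP => [fc|_]; last by rewrite addr_ge0.
  case: asboolP => [_|/contrapT fb]; first by rewrite lerDl.
  rewrite add0r asboolT//; case: b b' bb' fb fc => -[]// _ -> fc e;
    by apply: fc; rewrite ?e -?e.
pose b := t true < t false.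
have [c hc] := IH (upd w x b) us.
exists c; apply: (@le_trans _ _ (t b + h)); last first.
  rewrite /b; case: ltP => tt; rewrite addrC lerD2l; nra.
have c1 := step b true c hc; have c0 := step b false c hc.
have tb0 : 0 <= t b by apply: sumr_ge0 => z _; exact: Ex_ge0.
have h1 : (b != true)%:R * h <= h by case: b {c1 c0 hc tb0}; rewrite ?mul0r ?mul1r.
by case: b c1 c0 {hc tb0 h1} => /=; rewrite ?mul0r ?mul1r ?addr0 => c1 c0; nra.
Qed.

(** Conditionally on the other sites, [z] is already closed with probability
    [1 - p z], and then closing it changes nothing. *)
Lemma Ex_set0 p s z F w : is_prob p -> uniq s -> z \in s -> (forall w, 0 <= F w) ->
  (1 - p z) * Ex p s (fun w => F (upd w z false)) w <= Ex p s F w.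
Proof.
move=> hp us zs F0; have /andP[p0 p1] := hp z.
rewrite !(Ex_perm _ _ _ (perm_to_rem zs)) /=.
have zr : z \notin rem z s by rewrite mem_rem_uniqF.
have e b : Ex p (rem z s) (fun w => F (upd w z false)) (upd w z b)
         = Ex p (rem z s) F (upd w z false).
  rewrite !Ex_upd//; apply: eq_Ex => u; congr F.
  by apply/funext => y; rewrite /upd; case: eqVneq.
by rewrite !e -mulrDl [p z + _]addrC subrK mul1r lerDr mulr_ge0// Ex_ge0.
Qed.

(** The state of [z] is independent of an [F] that does not look at it. *)
Lemma Ex_centered p s z F w : uniq s -> z \in s ->
  depends_on (fun x => x != z) F -> Ex p s (fun w => (p z - (w z)%:R) * F w) w = 0.
Proof.
move=> us zs hF.
rewrite (Ex_perm _ _ _ (perm_to_rem zs)) /=.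
have zr : z \notin rem z s by rewrite mem_rem_uniqF.
rewrite !Ex_upd//.
have e b : Ex p (rem z s) (fun u => (p z - (upd u z b z)%:R) * F (upd u z b)) w
    = (p z - b%:R) * Ex p (rem z s) F w.
  rewrite -ExZ; apply: eq_Ex => u; rewrite upd_same; congr (_ * _).
  by apply: hF => x xz; rewrite upd_other.
by rewrite !e /= mulr1n mulr0n; ring.
Qed.

Lemma Ex_map (phi psi : T -> T) p s F w : cancel phi psi -> cancel psi phi ->
  Ex p (map phi s) F (w \o psi) = Ex (p \o phi) s (fun u => F (u \o psi)) w.
Proof.
move=> c1 c2; elim: s w => //= x s IH w.
have e b : upd (w \o psi) (phi x) b = upd w x b \o psi.
  by apply/funext => y; rewrite /upd /= -(can2_eq c2 c1).
by rewrite !e !IH.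
Qed.

(** Change of measure: reweighting each coordinate by a density [h] of
    mean one turns [p] into [p h(true)]. *)
Lemma Ex_tilt p h s F w : uniq s ->
  (forall x, p x * h x true + (1 - p x) * h x false = 1) ->
  Ex p s (fun w => F w * \prod_(x <- s) h x (w x)) w =
  Ex (fun x => p x * h x true) s F w.
Proof.
move=> us hh; elim: s w us => [|x s IH] w /=.
  by rewrite big_nil mulr1.
move=> /andP[xs us].
have e b : Ex p s (fun w => F w * \prod_(y <- x :: s) h y (w y)) (upd w x b)
   = h x b * Ex (fun x => p x * h x true) s F (upd w x b).
  rewrite -IH// !Ex_upd// -ExZ; apply: eq_Ex => u.
  by rewrite big_cons upd_same mulrCA.
rewrite !e !mulrA; congr (_ + _ * _).
by move: (hh x); lra.
Qed.

(** The densities of the coordinates that [F] does not see integrate to one. *)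
Lemma Ex_prod_free p h s t F w : uniq s -> uniq t -> {subset t <= s} ->
  (forall x, p x * h x true + (1 - p x) * h x false = 1) ->
  depends_on (fun x => x \in t) F ->
  Ex p s (fun w => F w * \prod_(x <- s) h x (w x)) w =
  Ex p s (fun w => F w * \prod_(x <- t) h x (w x)) w.
Proof.
move=> us ut ts hh hF; set r := [seq x <- s | x \notin t].
have st : perm_eq s (t ++ r).
  by rewrite perm_sym perm_catC perm_sym; exact: perm_cat_filter_notin.
have ur : uniq r by rewrite filter_uniq.
have rt x : x \in t -> x \notin r by rewrite mem_filter => ->.
have tr x : x \in r -> x \notin t by rewrite mem_filter => /andP[].
pose G w := F w * \prod_(x <- t) h x (w x).
rewrite !(Ex_perm _ _ _ st) !Ex_cat; apply: eq_Ex => u.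
have -> : Ex p r (fun w => F w * \prod_(x <- s) h x (w x)) u =
          Ex p r (fun w => G w * (1 * \prod_(x <- r) h x (w x))) u.
  by apply: eq_Ex => v; rewrite (perm_big _ st) big_cat /= mul1r mulrA.
have hG : depends_on (fun x => x \notin r) G.
  move=> v v' vv'; rewrite /G; congr (_ * _).
    by apply: hF => x /rt; exact: vv'.
  by rewrite big_seq [RHS]big_seq; apply: eq_bigr => x /rt /vv' ->.
by rewrite ExM_free// Ex_tilt// Ex_const mulr1 Ex_free.
Qed.

(** Partition according to the value of an observable [u] that takes its
    values in the list [l]. *)
Lemma sum_over_values (U : eqType) (l : seq U) (u : U) (H : U -> R) : u \in l ->
  \sum_(v <- undup l) (u == v)%:R * H v = H u.
Proof.
rewrite -mem_undup => ul.
rewrite (bigD1_seq u) ?undup_uniq//= eqxx mul1r big1 ?addr0// => v.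
by rewrite eq_sym => /negbTE ->; rewrite mul0r.
Qed.

(** A finite list of all the values that a random subset of [s] can take. *)
Definition subseqs s : seq (seq T) :=
  undup [seq mask (tval m) s | m <- enum {: (size s).-tuple bool}].

Lemma filter_subseqs (a : pred T) s :
  [seq x <- s | a x] \in [seq mask (tval m) s | m <- enum {: (size s).-tuple bool}].
Proof.
rewrite filter_mask; apply/mapP.
by exists [tuple of map a (in_tuple s)] => //; rewrite mem_enum.
Qed.

(** The analogue of a stopping time for an exploration: what has been revealed
    is enough to know that nothing else is going to be revealed. *)
Definition stopping_set (A : (T -> bool) -> T -> bool) :=
  forall w w', (forall x, A w x -> w x = w' x) -> A w = A w'.

Lemma stopping_set_value A s B : stopping_set A ->
  (forall w x, A w x -> x \in s) ->
  depends_on (fun x => x \in B) (fun w => [seq x <- s | A w x] == B).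
Proof.
move=> hA As w1 w2 ww; apply/eqP/eqP => e.
  by rewrite -(hA w1 w2)// => x Ax; apply: ww; rewrite -e mem_filter Ax (As w1).
rewrite -(hA w2 w1)// => x Ax; apply/esym/ww.
by rewrite -e mem_filter Ax (As w2).
Qed.

(** The weight [prod_(x in A w) h_x] is the likelihood ratio of what an
    exploration of the stopping set [A] has seen. On each event [A = B] the
    product may be completed to all of [s] at no cost, so the expectation is
    the total mass of the tilted measure. *)
Lemma Ex_stopping_prod A p h s w : uniq s -> stopping_set A ->
  (forall w x, A w x -> x \in s) ->
  (forall x, p x * h x true + (1 - p x) * h x false = 1) ->
  Ex p s (fun w => \prod_(x <- s | A w x) h x (w x)) w = 1.
Proof.
move=> us hA As hh; pose V w := [seq x <- s | A w x].
have VE u : \prod_(x <- s | A u x) h x (u x) =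
    \sum_(B <- subseqs s) (V u == B)%:R * \prod_(x <- B) h x (u x).
  by rewrite (sum_over_values (fun B => \prod_(x <- B) h x (u x))
    (filter_subseqs (A u) s)) big_filter.
transitivity (Ex p s (fun u => \sum_(B <- subseqs s) (V u == B)%:R *
    \prod_(x <- B) h x (u x)) w); first exact: eq_Ex.
rewrite Ex_sum -[RHS](Ex_const (fun x => p x * h x true) s 1 w).
transitivity (\sum_(B <- subseqs s) Ex (fun x => p x * h x true) s (fun u => (V u == B)%:R) w).
  rewrite big_seq [RHS]big_seq; apply: eq_bigr => B.
  rewrite mem_undup => /mapP[m _ ->].
  have sub : {subset mask m s <= s} by exact: mem_subseq (mask_subseq _ _).
  rewrite -Ex_tilt// (Ex_prod_free (t := mask m s))// ?mask_uniq//.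
  by move=> w1 w2 ww; rewrite /V (stopping_set_value hA As ww).
rewrite -Ex_sum; apply: eq_Ex => u.
rewrite -[RHS](sum_over_values (fun=> 1) (filter_subseqs (A u) s)).
by apply: eq_bigr => B _; rewrite mulr1.
Qed.

(** Given a stopping set, what lies outside it is fresh: if on [A = B] the
    event [F] is seen inside [B] and [G B] only looks outside [B], then
    [G] keeps its unconditional bound. *)
Lemma Ex_stopping_indep A p s F (G : seq T -> (T -> bool) -> R) c w : is_prob p ->
  uniq s -> stopping_set A -> (forall w x, A w x -> x \in s) ->
  (forall w w', (forall x, A w x -> w x = w' x) -> F w = F w') ->
  (forall w, 0 <= F w) ->
  (forall B, depends_on (fun x => x \notin B) (G B)) ->
  (forall B, Ex p s (G B) w <= c) ->
  Ex p s (fun w => F w * G [seq x <- s | A w x] w) w <= Ex p s F w * c.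
Proof.
move=> hp us hA As hF F0 hG hc; pose V w := [seq x <- s | A w x].
have sumV u (H : seq T -> R) : H (V u) = \sum_(B <- subseqs s) (V u == B)%:R * H B.
  by rewrite (sum_over_values H (filter_subseqs (A u) s)).
have -> : Ex p s (fun w => F w * G (V w) w) w =
    \sum_(B <- subseqs s) Ex p s (fun u => ((V u == B)%:R * F u) * G B u) w.
  rewrite -Ex_sum; apply: eq_Ex => u.
  rewrite (sumV u (fun B => F u * G B u)); apply: eq_bigr => B _.
  by rewrite mulrA.
have -> : Ex p s F w = \sum_(B <- subseqs s) Ex p s (fun u => (V u == B)%:R * F u) w.
  by rewrite -Ex_sum; apply: eq_Ex => u; rewrite -(sumV u (fun=> F u)).
rewrite mulr_suml big_seq [leRHS]big_seq; apply: ler_sum => B.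
rewrite mem_undup => /mapP[m _ BE].
have uB : uniq B by rewrite BE mask_uniq.
have sub : {subset B <= s} by rewrite BE; exact: mem_subseq (mask_subseq _ _).
have st := perm_cat_filter_notin uB us sub.
have hVF : depends_on (fun x => x \in B) (fun u => (V u == B)%:R * F u).
  move=> u u' uu'; rewrite (stopping_set_value hA As uu').
  case: eqP => [e|_]; last by rewrite !mul0r.
  congr (_ * _); apply/esym/hF => x Ax; apply/esym/uu'.
  by rewrite -e mem_filter Ax (As u').
have hVF' : depends_on (fun x => x \notin [seq x <- s | x \notin B])
    (fun u => (V u == B)%:R * F u).
  by apply: depends_on_sub hVF => x xB; rewrite mem_filter xB.
have sr : {subset [seq x <- s | x \notin B] <= s}.
  by move=> x; rewrite mem_filter => /andP[].
set r := [seq x <- s | x \notin B] in st hVF' sr *.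
have rs : perm_eq s (B ++ r) by rewrite perm_sym perm_catC perm_sym.
have hGr : depends_on (fun x => x \notin B) (G B) := hG B.
rewrite (Ex_perm _ _ _ rs) Ex_indep//.
rewrite (Ex_perm p (fun u => _ * F u) w rs) Ex_cat.
have -> : Ex p B (Ex p r (fun u => (V u == B)%:R * F u)) w =
    Ex p B (fun u => (V u == B)%:R * F u) w.
  by apply: eq_Ex => u; rewrite Ex_free.
apply: ler_wpM2l; first by apply: Ex_ge0 => // u; rewrite mulr_ge0.
rewrite (le_trans _ (hc B))// (Ex_perm _ _ _ rs) Ex_cat (@Ex_free p B)// => u u' uu'.
by apply: (Ex_eq_outside _ hGr) => x _; exact: uu'.
Qed.

End Expectation.

(** * Geometry of the lattice *)

Section Lattice.
Variables (R : realType) (d : nat).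
Implicit Types (x y z c : site d) (w : configuration d) (A B : set (site d)).

Local Notation nb := (@neighbor R d).

Lemma site_eq x y : (forall i, x ord0 i = y ord0 i) -> x = y.
Proof. by move=> h; apply/rowP => i; exact: h. Qed.

Lemma siteD x y i : (x + y) ord0 i = x ord0 i + y ord0 i :> int.
Proof. by rewrite mxE. Qed.

Lemma siteB x y i : (x - y) ord0 i = x ord0 i - y ord0 i :> int.
Proof. by rewrite !mxE. Qed.

Lemma site_stepE x i (b : bool) j :
  (x + (-1) ^+ b *: delta_mx ord0 i) ord0 j =
  x ord0 j + (if j == i then (if b then -1 else 1) else 0) :> int.
Proof. by rewrite !mxE eqxx /=; case: eqP; case: b; rewrite ?mulr1 ?mulr0. Qed.

Lemma neighborE x y : nb x y = (\sum_(i < d) (x ord0 i - y ord0 i) ^+ 2 == 1).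
Proof.
rewrite /neighbor /euclidean_norm.
have -> : \sum_(i < d) ((x - y) ord0 i)%:~R ^+ 2 =
    (\sum_(i < d) (x ord0 i - y ord0 i) ^+ 2)%:~R :> R.
  rewrite rmorph_sum /=; apply: eq_bigr => i _.
  by rewrite !mxE rmorphXn.
set s := \sum_(i < d) _; have s0 : 0 <= s by apply: sumr_ge0 => i _; exact: sqr_ge0.
rewrite -(@eqr_int R) -[X in _ == X%:~R]/(1 : int) -[1%:~R]/(1 : R).
apply/eqP/eqP => [h|->]; last by rewrite sqrtr1.
by rewrite -[LHS]sqr_sqrtr ?ler0z// h expr1n.
Qed.

Lemma neighbor_sym x y : nb x y = nb y x.
Proof.
by rewrite !neighborE; congr (_ == _); apply: eq_bigr => i _; rewrite -sqrrN opprB.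
Qed.

Lemma neighbor_coord x y : nb x y ->
  exists i, exists b : bool, y = x + (-1) ^+ b *: delta_mx ord0 i.
Proof.
rewrite neighborE => /eqP h.
have [i hi] : exists i, x ord0 i - y ord0 i != 0.
  apply/not_existsP => H; have : \sum_(i < d) (x ord0 i - y ord0 i) ^+ 2 = 0.
    by apply: big1 => i _; have /negP := H i; rewrite negbK => /eqP ->; rewrite expr0n.
  by rewrite h.
rewrite (bigD1 i)//= in h; set s := \sum_(j < d | _) _ in h.
have s0 : 0 <= s by apply: sumr_ge0 => j _; exact: sqr_ge0.
have t0 : 0 < (x ord0 i - y ord0 i) ^+ 2 by rewrite exprn_even_gt0.
have e1 : (x ord0 i - y ord0 i) ^+ 2 = 1.
  by move: t0 h; set t := _ ^+ 2 => t0 h; lia.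
rewrite e1 in h.
have es : s = 0 by apply: (addrI 1); rewrite h addr0.
have ej j : j != i -> y ord0 j = x ord0 j.
  move=> ji; have /eqP := es; rewrite psumr_eq0; last by move=> k _; exact: sqr_ge0.
  move=> /allP /(_ j); rewrite mem_index_enum ji /= sqrf_eq0 subr_eq0 => /(_ isT) /eqP //.
exists i, (x ord0 i - y ord0 i == 1); apply: site_eq => j; rewrite site_stepE.
have [->|ji] := eqVneq j i; last by rewrite addr0 ej.
have : (x ord0 i - y ord0 i == 1) || (x ord0 i - y ord0 i == -1).
  by rewrite -sqrf_eq1 e1.
by move=> /orP[] /eqP e; rewrite e /=; lia.
Qed.

Lemma neighbor_step x i (b : bool) : nb x (x + (-1) ^+ b *: delta_mx ord0 i).
Proof.
rewrite neighborE (bigD1 i)//= big1 ?addr0 => [|j ji]; last first.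
  by rewrite !mxE (negbTE ji) andbF mulr0 addr0 subrr expr0n.
by rewrite !mxE !eqxx /= mulr1 opprD addNKr sqrrN sqrr_sign.
Qed.

Definition nbrs x : seq (site d) :=
  [seq x + (-1) ^+ ib.2 *: delta_mx ord0 ib.1 | ib : 'I_d * bool].

Lemma mem_nbrs x y : (y \in nbrs x) = nb x y.
Proof.
rewrite /nbrs; apply/idP/idP => [/fintype.imageP[[i b] _ ->]|/neighbor_coord[i [b ->]]].
  exact: neighbor_step.
by apply/fintype.imageP; exists (i, b).
Qed.

Lemma size_nbrs x : size (nbrs x) = (2 * d)%N.
Proof. by rewrite size_image card_prod card_ord card_bool mulnC. Qed.

Lemma neighbor_dist x y i : nb x y ->
  x ord0 i - 1 <= y ord0 i <= x ord0 i + 1.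
Proof.
move=> /neighbor_coord[j [b ->]]; rewrite site_stepE.
by case: eqP => _; case: b; lia.
Qed.

Lemma neighborD c x y : nb (x + c) (y + c) = nb x y.
Proof.
rewrite !neighborE; congr (_ == _); apply: eq_bigr => i _; rewrite !mxE.
by congr (_ ^+ 2); ring.
Qed.

Lemma boxP c n x :
  box c n x <-> forall i, c ord0 i - n%:Z <= x ord0 i <= c ord0 i + n%:Z.
Proof.
split => [[y hy <-] i|h]; first by have := hy i; rewrite siteD; lia.
by exists (x - c); [move=> i; have := h i; rewrite siteB; lia|rewrite addrC subrK].
Qed.

Lemma box_center c n : box c n c.
Proof. by apply/boxP => i; lia. Qed.

Lemma inner_boundaryP c n x : inner_boundary R (box c n) x <->
  box c n x /\ exists i, x ord0 i = c ord0 i + n%:Z \/ x ord0 i = c ord0 i - n%:Z.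
Proof.
split=> [[bx [y [nby xy]]]|[bx [i hi]]]; split => //.
  apply: contrapT => H; apply: nby; apply/boxP => i.
  have := neighbor_dist i xy; have /boxP/(_ i) := bx.
  have : ~ (x ord0 i = c ord0 i + n%:Z \/ x ord0 i = c ord0 i - n%:Z).
    by move=> h; apply: H; exists i.
  by lia.
have [b hb] : exists b : bool, x ord0 i = c ord0 i + (-1) ^+ b * n%:Z.
  by case: hi => ->; [exists false|exists true]; rewrite ?expr0 ?expr1; lia.
exists (x + (-1) ^+ b *: delta_mx ord0 i); split; last exact: neighbor_step.
move=> /boxP/(_ i); rewrite site_stepE eqxx hb.
by case: (b); rewrite ?expr0 ?expr1 ?mul1r ?mulN1r; lia.
Qed.

Definition grid (l : 'I_d -> seq int) : seq (site d) :=
  [seq \row_j nth 0 (l j) (f j) | f : {dffun forall j, 'I_(size (l j))}].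

Lemma mem_grid l x : (x \in grid l) = [forall j, x ord0 j \in l j].
Proof.
rewrite /grid; apply/idP/forallP => [/fintype.imageP[f _ ->] j|h].
  by rewrite mxE mem_nth.
have hi j : (index (x ord0 j) (l j) < size (l j))%N by rewrite index_mem.
apply/fintype.imageP; exists (finfun (fun j => Ordinal (hi j))) => //.
by apply: site_eq => j; rewrite mxE ffunE /= nth_index.
Qed.

Lemma size_grid l : size (grid l) = (\prod_j size (l j))%N.
Proof.
rewrite size_image card_dep_ffun foldrE big_map big_enum /=.
by apply: eq_bigr => j _; rewrite card_ord.
Qed.

Lemma grid_uniq l : (forall j, uniq (l j)) -> uniq (grid l).
Proof.
move=> hl; rewrite map_inj_uniq ?enum_uniq// => f g /rowP e.
apply/ffunP => j; apply/val_inj => /=.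
by have := e j; rewrite !mxE => /eqP; rewrite nth_uniq// => /eqP.
Qed.

Definition interval_list (a : int) (n : nat) : seq int :=
  [seq a + k%:Z | k <- iota 0 n].

Lemma mem_interval_list a n (k : int) : (k \in interval_list a n) = (a <= k < a + n%:Z).
Proof.
apply/mapP/idP => [[m]|h]; first by rewrite mem_iota => h ->; lia.
by exists `|k - a|%N; [rewrite mem_iota; lia|lia].
Qed.

Lemma interval_list_uniq a n : uniq (interval_list a n).
Proof. by rewrite map_inj_uniq ?iota_uniq// => i j /addrI []. Qed.

Lemma size_interval_list a n : size (interval_list a n) = n.
Proof. by rewrite size_map size_iota. Qed.

Definition bx c n : seq (site d) :=
  grid (fun j => interval_list (c ord0 j - n%:Z) (2 * n).+1).

Lemma mem_bx c n x : (x \in bx c n) <-> box c n x.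
Proof.
rewrite mem_grid boxP; split => [/forallP h i|h].
  by have := h i; rewrite mem_interval_list; lia.
by apply/forallP => i; rewrite mem_interval_list; have := h i; lia.
Qed.

Lemma bx_uniq c n : uniq (bx c n).
Proof. by apply: grid_uniq => j; exact: interval_list_uniq. Qed.

Lemma size_bx c n : size (bx c n) = ((2 * n).+1 ^ d)%N.
Proof.
rewrite size_grid (eq_bigr (fun=> (2 * n).+1)) => [|j _].
  by rewrite prod_nat_const card_ord.
exact: size_interval_list.
Qed.

Lemma box_sub c c' n m : (forall i, `|c ord0 i - c' ord0 i| + n%:Z <= m%:Z) ->
  box c n `<=` box c' m.
Proof.
move=> h x /boxP hx; apply/boxP => i; have := hx i; have := h i.
by lia.
Qed.

End Lattice.

(** * Connections *)

Section Connections.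
Variables (R : realType) (d : nat).
Implicit Types (x y z c : site d) (w : configuration d) (A B : set (site d)).

Local Notation nb := (@neighbor R d).
Local Notation conn := (@connected_in R d).

(** Induction along a path. The step may use that the site reached so far is
    itself connected to [x]. *)
Lemma connected_ind w A x (Q : site d -> Prop) : Q x ->
  (forall a b, conn w A x a -> Q a -> nb a b -> open_in w A b -> Q b) ->
  forall y, conn w A x y -> Q y.
Proof.
move=> Qx step y [s [ps <-]]; elim/last_ind: s ps => [|s b IH]//=.
rewrite rcons_path last_rcons => /andP[ps eb] op.
have ops z : z \in x :: s -> open_in w A z.
  by move=> zs; apply: op; rewrite -rcons_cons mem_rcons inE zs orbT.
apply: (step (last x s)) => //; first by exists s.
  exact: IH.
by apply: op; rewrite -rcons_cons mem_rcons mem_head.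
Qed.

Lemma connected_refl w A x : open_in w A x -> conn w A x x.
Proof. by move=> ox; exists [::]; split => // z; rewrite inE => /eqP ->. Qed.

Lemma connected_step w A x y z : conn w A x y -> nb y z -> open_in w A z ->
  conn w A x z.
Proof.
move=> [s [ps <- op]] yz oz; exists (rcons s z); split.
- by rewrite rcons_path ps.
- by rewrite last_rcons.
- move=> u; rewrite -rcons_cons mem_rcons inE => /orP[/eqP ->//|]; exact: op.
Qed.

Lemma connected_openl w A x y : conn w A x y -> open_in w A x.
Proof. by move=> [s [_ _]]; apply; rewrite mem_head. Qed.

Lemma connected_openr w A x y : conn w A x y -> open_in w A y.
Proof. by move=> [s [_ <-]]; apply; exact: mem_last. Qed.

Lemma connected_trans w A x y z : conn w A x y -> conn w A y z -> conn w A x z.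
Proof.
move=> xy; apply: (connected_ind (Q := conn w A x)) => // a b _.
exact: connected_step.
Qed.

Lemma connected_sym w A x y : conn w A x y -> conn w A y x.
Proof.
move=> xy; have := connected_openl xy.
move: y xy; apply: (connected_ind (Q := fun y => _ -> conn w A y x)).
  exact: connected_refl.
move=> a b xa IH ab ob ox; apply: (@connected_trans _ _ _ a); last exact: IH.
apply: (@connected_step _ _ _ b) => //; first exact: connected_refl.
  by rewrite neighbor_sym.
exact: connected_openr xa.
Qed.

Lemma connected_mono w w' A B x y :
  (forall z, open_in w A z -> open_in w' B z) -> conn w A x y -> conn w' B x y.
Proof.
move=> h xy; have ox := h _ (connected_openl xy).
move: y xy; apply: (connected_ind (Q := conn w' B x)) => [|a b _ xa ab ob].
  exact: connected_refl.
exact: connected_step xa ab (h _ ob).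
Qed.

(** Either the path never leaves [Q], or it is cut at its first exit. *)
Lemma connected_split w A (Q : set (site d)) x y : conn w A x y -> Q x ->
  conn w (A `&` Q) x y \/
  exists a b, [/\ conn w (A `&` Q) x a, nb a b, open_in w A b & ~ Q b].
Proof.
move=> xy Qx; have ox := connected_openl xy.
move: y xy; apply: connected_ind => [|a b xa [IH|//] ab ob].
  by left; apply: connected_refl; case: ox.
  have [Qb|nQb] := pselect (Q b); last by right; exists a, b.
  by left; apply: connected_step IH ab _; case: ob.
by right.
Qed.

Lemma connected_exit w A (Q : set (site d)) x y :
  conn w A x y -> Q x -> ~ Q y ->
  exists a b, [/\ conn w (A `&` Q) x a, nb a b, open_in w A b & ~ Q b].
Proof.
by move=> xy Qx nQy; case: (connected_split xy Qx) => [/connected_openr[[]]|].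
Qed.

Lemma connected_boundary w A B x y : conn w A x y -> B x -> ~ B y ->
  exists2 a, inner_boundary R B a & conn w (A `&` B) x a.
Proof.
move=> xy Bx nBy; have [a [b [xa ab _ nBb]]] := connected_exit xy Bx nBy.
exists a => //; split; last by exists b.
by have [[]] := connected_openr xa.
Qed.

(** The clusters of two sites are distinct exactly when no path joins the two
    sites, so that clusters can be traded for paths. *)
Lemma two_armsP x n w : two_arms R x n w <->
  exists y z a b, [/\ nb x y /\ nb x z, ~ conn w (box x n) y z,
    conn w (box x n) y a /\ inner_boundary R (box x n) a &
    conn w (box x n) z b /\ inner_boundary R (box x n) b].
Proof.
split.
  move=> [y [z [C [D [[xy xz] [[u ou <-] [v ov <-]] CD [uy vz] [[a [ua ba]] [b [vb bb]]]]]]]].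
  exists y, z, a, b; split; first by split.
  - move=> yz; apply: CD; have uv : conn w (box x n) u v.
      exact: connected_trans (connected_trans uy yz) (connected_sym vz).
    apply/seteqP; split => t; last exact: connected_trans.
    exact: connected_trans (connected_sym uv).
  - by split; [exact: connected_trans (connected_sym uy) ua|].
  - by split; [exact: connected_trans (connected_sym vz) vb|].
move=> [y [z [a [b [[xy xz] nyz [ya ba] [zb bb]]]]]].
exists y, z, (Defs.cluster R w (box x n) y), (Defs.cluster R w (box x n) z); split.
- by split.
- by split; [exists y|exists z]; [exact: connected_openl ya| |exact: connected_openl zb|].
- move=> e; apply: nyz; have : Defs.cluster R w (box x n) z z.
    exact: connected_refl (connected_openl zb).
  by rewrite -e.
- by split; apply: connected_refl; [exact: connected_openl ya|exact: connected_openl zb].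
- by split; [exists a|exists b].
Qed.

(** An open centre would join its two neighbours. *)
Lemma two_arms_closed x n w : two_arms R x n w -> w x = false.
Proof.
move=> /two_armsP[y [z [a [b [[xy xz] nyz [ya _] [zb _]]]]]].
apply/negbTE/negP => wx; apply: nyz.
have ox : open_in w (box x n) x by split => //; exact: box_center.
apply: (@connected_trans _ _ _ x).
  apply: (connected_step (connected_refl (connected_openl ya))) => //.
  by rewrite neighbor_sym.
exact: connected_step (connected_refl ox) xz (connected_openl zb).
Qed.

Lemma neighbor_box x y n : nb x y -> (0 < n)%N -> box x n y.
Proof. by move=> xy n0; apply/boxP => i; have := neighbor_dist i xy; lia. Qed.

Lemma two_arms_anti x n m w : (0 < n <= m)%N -> two_arms R x m w -> two_arms R x n w.
Proof.
move=> /andP[n0 nm] /two_armsP[y [z [a [b [[xy xz] nyz [ya ba] [zb bb]]]]]].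
have sub : box x n `<=` box x m by apply: box_sub => i; lia.
have reach u e : nb x u -> conn w (box x m) u e -> inner_boundary R (box x m) e ->
    exists2 e', conn w (box x n) u e' & inner_boundary R (box x n) e'.
  move=> xu ue be; have bu := neighbor_box xu n0.
  have [be'|nbe] := pselect (box x n e).
    have [k hk] : exists k, e ord0 k = x ord0 k + m%:Z \/ e ord0 k = x ord0 k - m%:Z.
      by have /inner_boundaryP[] := be.
    have nmE : n = m by move/boxP: be' => /(_ k); lia.
    by rewrite nmE; exists e.
  have [e' be' ue'] := connected_boundary ue bu nbe.
  by exists e'; [apply: connected_mono ue' => t [[_ ?] ?]|].
have [a' ya' ba'] := reach _ _ xy ya ba; have [b' zb' bb'] := reach _ _ xz zb bb.
apply/two_armsP; exists y, z, a', b'; split; [by []| |by split|by split].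
move=> yz; apply: nyz.
by apply: connected_mono yz => t [/sub ? ?].
Qed.

Lemma connected_depends A x y :
  depends_on (fun z => A z) (fun w => `[< conn w A x y >]).
Proof.
move=> w w' ww'; apply/asboolP/asboolP; apply: connected_mono => z [Az oz];
  split => //; by rewrite -?ww'// ww'.
Qed.

Lemma connected_in_congr A x y w w' : (forall z, A z -> w z = w' z) ->
  conn w A x y -> conn w' A x y.
Proof. by move=> ww'; apply: connected_mono => z [Az oz]; split => //; rewrite -ww'. Qed.

Lemma two_arms_depends x n :
  depends_on (fun z => box x n z) (fun w => `[< two_arms R x n w >]).
Proof.
suff h w w' : (forall z, box x n z -> w z = w' z) -> two_arms R x n w -> two_arms R x n w'.
  by move=> w w' ww'; apply/asboolP/asboolP; apply: h => // z /ww' ->.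
move=> ww' /two_armsP[y [z [a [b [nn nyz [ya ba] [zb bb]]]]]].
apply/two_armsP; exists y, z, a, b; split; first exact: nn.
- by move=> yz; apply: nyz; apply: connected_in_congr yz => u /ww' ->.
- by split; [exact: connected_in_congr ya|].
- by split; [exact: connected_in_congr zb|].
Qed.

(** The sites examined when the cluster of [x] in [A] is explored. The site [x]
    is listed apart because it is examined even if it turns out to be closed, in
    which case its cluster is empty. *)
Definition explored A w x y : bool :=
  `[< A y /\ (y = x \/ exists2 z, conn w A x z & nb z y) >].

Lemma connected_explored A w x y : conn w A x y -> explored A w x y.
Proof.
move=> xy; apply/asboolP; split; first by have [] := connected_openr xy.
move: y xy; apply: connected_ind => [|a b xa _ ab _]; first by left.
by right; exists a.
Qed.

Lemma explored_open A w x y : open_in w A x -> explored A w x y -> w y ->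
  conn w A x y.
Proof.
move=> ox /asboolP[Ay [->|[z xz zy]]] wy; first exact: connected_refl.
exact: connected_step xz zy _.
Qed.

(** A path from [x] can leave the cluster of [x] in [w] only through a closed
    site that has been explored, and there [w] and [w'] agree. *)
Lemma connected_stopping A x y w w' :
  (forall z, explored A w x z -> w z = w' z) -> conn w A x y <-> conn w' A x y.
Proof.
move=> ww'; split => xy.
  have [Ax wx] := connected_openl xy.
  have ex : explored A w x x by apply/asboolP; split => //; left.
  move: y xy; apply: (connected_ind (Q := conn w' A x)).
    by apply: connected_refl; split => //; rewrite -ww'.
  move=> a b xa xa' ab ob; apply: (connected_step xa' ab).
  have [Ab wb] := ob; split => //; rewrite -ww'//.
  by apply: connected_explored; exact: connected_step xa ab ob.
have [Ax wx] := connected_openl xy.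
have ex : explored A w x x by apply/asboolP; split => //; left.
move: y xy; apply: (connected_ind (Q := conn w A x)).
  by apply: connected_refl; split => //; rewrite ww'.
move=> a b xa' xa ab [Ab wb]; apply: (connected_step xa ab); split => //.
by rewrite ww'//; apply/asboolP; split => //; right; exists a.
Qed.

Lemma explored_stopping A x : stopping_set (fun w => explored A w x).
Proof.
move=> w w' ww'; apply/funext => y.
have e z := connected_stopping z ww'.
apply/asboolP/asboolP => -[Ay]; case=> [yx|[z xz zy]].
- by split; [exact: Ay|left].
- by split; [exact: Ay|right; exists z; [apply/e|]].
- by split; [exact: Ay|left].
- by split; [exact: Ay|right; exists z; [apply/e|]].
Qed.

End Connections.

(** * Finite-range events under the percolation measure *)

Section FiniteRange.
Variables (R : realType) (d : nat).
Implicit Types (w v : configuration d) (s : seq (site d)) (E : configuration d -> Prop).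

Lemma measurable_site (x : site d) (b : bool) :
  measurable ([set w : configuration d | w x = b] : set (configurations d)).
Proof.
have h : measurable ([set w : configuration d | w x] : set (configurations d)).
  by apply: sub_sigma_algebra; exists x.
case: b; first by [].
rewrite [X in measurable X](_ : _ = ~` [set w : configuration d | w x]).
  exact: measurableC.
by apply/seteqP; split => w /= /negP; [case: (w x)|move/negbTE].
Qed.

Lemma measurable_cylinder s v :
  measurable ([set w : configuration d | {in s, w =1 v}] : set (configurations d)).
Proof.
elim: s => [|x s IH].
  rewrite [X in measurable X](_ : _ = setT) //.
  by apply/seteqP; split => w.
rewrite [X in measurable X](_ : _ = [set w : configuration d | w x = v x] `&`
    [set w : configuration d | {in s, w =1 v}]).
  by apply: measurableI IH; exact: measurable_site.
apply/seteqP; split => w /=.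
  move=> h; split; first by apply: h; rewrite mem_head.
  by move=> y ys; apply: h; rewrite inE ys orbT.
by move=> [h1 h2] y; rewrite inE => /orP[/eqP ->//|]; exact: h2.
Qed.

Variables (P : R -> probability (configurations d) R) (hP : site_percolation P).

(** On the coordinates of [s1] the configuration is prescribed. Prescribing one
    more coordinate splits the event into two disjoint halves, exactly as the
    recursion that defines [Ex] does, until it is a cylinder or empty. *)
Lemma percolation_cylinder_Ex (p : R) s1 s2 v E : 0 <= p <= 1 -> uniq (s2 ++ s1) ->
  depends_on (fun x => x \in s2 ++ s1) (fun w => `[< E w >]) ->
  measurable ([set w : configuration d | E w /\ {in s1, w =1 v}] : set (configurations d)) /\
  P p [set w : configuration d | E w /\ {in s1, w =1 v}] =
  (\prod_(x <- s1) bernoulli_pmf p (v x) *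
   Ex (fun=> p) s2 (fun w => `[< E w >]%:R) v)%:E.
Proof.
move=> hp; elim: s2 s1 v => [|x s2 IH] s1 v /=.
  move=> us1 hE; have [Ev|nEv] := pselect (E v).
    have e : [set w : configuration d | E w /\ {in s1, w =1 v}] =
        [set w : configuration d | {in s1, w =1 v}].
      apply/seteqP; split => w /=; first by move=> [].
      move=> wv; split => //; apply/asboolP; rewrite (hE w v) ?asboolT//.
    by rewrite e asboolT// mulr1; split; [exact: measurable_cylinder|exact: hP].
  have e : [set w : configuration d | E w /\ {in s1, w =1 v}] = set0.
    apply/seteqP; split => w //= [Ew wv]; apply: nEv; apply/asboolP.
    by rewrite -(hE w v) ?asboolT.
  by rewrite e asboolF// mulr0; split; [exact: measurable0|rewrite measure0].
move=> /andP[]; rewrite mem_cat negb_or => /andP[xs2 xs1] us hE.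
have us' : uniq (s2 ++ x :: s1) 
  by rewrite -cat1s uniq_catCA /= mem_cat negb_or xs1 xs2.
have hE' : depends_on (fun y => y \in s2 ++ x :: s1) (fun w => `[< E w >]).
  apply: depends_on_sub hE => y; rewrite !(inE, mem_cat).
  by case/orP=> [->|/orP[->|->]]; rewrite ?orbT.
have inb b w : {in x :: s1, w =1 upd v x b} <-> w x = b /\ {in s1, w =1 v}.
  split=> [h|[wx h] y].
    split; first by rewrite h ?mem_head// upd_same.
    move=> y ys; rewrite h ?inE ?ys ?orbT// upd_other//.
    by apply: contraNneq xs1 => <-.
  rewrite inE => /orP[/eqP ->|ys]; first by rewrite upd_same.
  by rewrite h// upd_other//; apply: contraNneq xs1 => <-.
have prodb b : \prod_(y <- x :: s1) bernoulli_pmf p (upd v x b y) =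
    bernoulli_pmf p b * \prod_(y <- s1) bernoulli_pmf p (v y).
  rewrite big_cons upd_same; congr (_ * _).
  rewrite big_seq [RHS]big_seq; apply: eq_bigr => y ys.
  by rewrite upd_other//; apply: contraNneq xs1 => <-.
have [mt ht] := IH _ (upd v x true) us' hE'.
have [mf hf] := IH _ (upd v x false) us' hE'.
have -> : [set w : configuration d | E w /\ {in s1, w =1 v}] =
    [set w : configuration d | E w /\ {in x :: s1, w =1 upd v x true}] `|`
    [set w : configuration d | E w /\ {in x :: s1, w =1 upd v x false}].
  apply/seteqP; split => w /=.
    move=> [Ew wv]; case wx : (w x); [left|right]; split => //; exact/inb.
  by move=> [] [Ew /inb[_ ?]].
split; first exact: measurableU.
rewrite measureU//; last first.
  by apply/seteqP; split => w //= [[_ /inb[e1 _]] [_ /inb[e2 _]]]; rewrite e1 in e2.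
transitivity ((\prod_(y <- x :: s1) bernoulli_pmf p (upd v x true y) *
   Ex (fun=> p) s2 (fun w => `[< E w >]%:R) (upd v x true))%:E +
  (\prod_(y <- x :: s1) bernoulli_pmf p (upd v x false y) *
   Ex (fun=> p) s2 (fun w => `[< E w >]%:R) (upd v x false))%:E)%E.
  by rewrite -ht -hf.
rewrite -EFinD !prodb /bernoulli_pmf; congr (_%:E).
by ring.
Qed.

(** For an event that depends on [s] only, every other base configuration gives
    the same value. *)
Definition Pr (p : R) s E : R :=
  Ex (fun=> p) s (fun w => `[< E w >]%:R) (fun=> false).

Lemma percolation_Pr (p : R) s E : 0 <= p <= 1 -> uniq s ->
  depends_on (fun x => x \in s) (fun w => `[< E w >]) ->
  measurable ([set w : configuration d | E w] : set (configurations d)) /\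
  P p [set w : configuration d | E w] = (Pr p s E)%:E.
Proof.
move=> hp us hE.
have := @percolation_cylinder_Ex p [::] s (fun=> false) E hp.
rewrite cats0 big_nil mul1r => /(_ us hE).
have -> // : [set w : configuration d | E w /\ {in [::], w =1 (fun=> false)}] =
    [set w : configuration d | E w].
by apply/seteqP; split => w /=; [move=> []|split].
Qed.

End FiniteRange.

(** * Invariance and elementary estimates *)

Section Invariance.
Variables (R : realType) (d : nat).
Implicit Types (p : R) (x y z c : site d) (w v : configuration d) (s : seq (site d)).
Implicit Types (E F : configuration d -> Prop) (A B : set (site d)).

Local Notation nb := (@neighbor R d).
Local Notation conn := (@connected_in R d).

Lemma is_prob_const (T : eqType) (p : R) : 0 <= p <= 1 -> is_prob (fun _ : T => p).
Proof. by move=> hp x. Qed.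

Lemma ler_indicator (E F : Prop) : (E -> F) -> `[< E >]%:R <= `[< F >]%:R :> R.
Proof.
by move=> EF; case: asboolP => [/EF h|_]; [rewrite asboolT|rewrite ler0n].
Qed.

Lemma indicator_congr (E F : Prop) : (E <-> F) -> `[< E >]%:R = `[< F >]%:R :> R.
Proof. by move=> EF; rewrite (asbool_equiv_eq EF). Qed.

Lemma ler_term_sum (I : eqType) (l : seq I) (i : I) (F : I -> R) :
  i \in l -> (forall j, 0 <= F j) -> F i <= \sum_(j <- l) F j.
Proof.
move=> il F0; rewrite (perm_big _ (perm_to_rem il)) big_cons lerDl.
exact: sumr_ge0.
Qed.

Lemma indicator_le_sum (E : Prop) (I : eqType) (l : seq I) (F : I -> Prop) :
  (E -> exists2 i, i \in l & F i) ->
  `[< E >]%:R <= \sum_(i <- l) `[< F i >]%:R :> R.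
Proof.
move=> h; case: asboolP => [/h[i il Fi]|_]; last by apply: sumr_ge0.
rewrite -[leLHS](_ : `[< F i >]%:R = _); last by rewrite asboolT.
exact: (ler_term_sum (F := fun i => `[< F i >]%:R)).
Qed.

Lemma le_Pr p s E F : 0 <= p <= 1 -> (forall w, E w -> F w) ->
  Pr p s E <= Pr p s F.
Proof.
move=> hp EF; apply: le_Ex; first exact: is_prob_const.
by move=> w; apply: ler_indicator; exact: EF.
Qed.

Lemma Pr_ge0 p s E : 0 <= p <= 1 -> 0 <= Pr p s E.
Proof. by move=> hp; apply: Ex_ge0 => //; exact: is_prob_const. Qed.

Lemma Pr_le1 p s E : 0 <= p <= 1 -> Pr p s E <= 1.
Proof.
move=> hp; rewrite -(Ex_const (fun=> p) s 1 (fun=> false)).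
apply: le_Ex; first exact: is_prob_const.
by move=> w; case: asboolP.
Qed.

Lemma Pr_le_sum p s E (I : eqType) (l : seq I) (F : I -> configuration d -> Prop) :
  0 <= p <= 1 -> (forall w, E w -> exists2 i, i \in l & F i w) ->
  Pr p s E <= \sum_(i <- l) Pr p s (F i).
Proof.
move=> hp EF; rewrite -Ex_sum; apply: le_Ex; first exact: is_prob_const.
by move=> w; apply: indicator_le_sum; exact: EF.
Qed.

Lemma Pr_marginal p s S E w : uniq s -> uniq S -> {subset s <= S} ->
  depends_on (fun x => x \in s) (fun w => `[< E w >]) ->
  Ex (fun=> p) S (fun w => `[< E w >]%:R) w = Pr p s E.
Proof.
move=> us uS sS hE; apply: Ex_marginal => //.
by move=> u u' /hE ->.
Qed.

Lemma sub_bx c n c' m : box c n `<=` box c' m -> {subset bx c n <= bx c' m}.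
Proof. by move=> h x /mem_bx /h /mem_bx. Qed.

Lemma depends_on_bx (U : Type) c n (f : configuration d -> U) :
  depends_on (box c n) f -> depends_on (fun x => x \in bx c n) f.
Proof. by apply: depends_on_sub => x /mem_bx. Qed.

Lemma connected_map (phi : site d -> site d) w w' A B x y :
  (forall a b, nb a b -> nb (phi a) (phi b)) ->
  (forall z, open_in w A z -> open_in w' B (phi z)) ->
  conn w A x y -> conn w' B (phi x) (phi y).
Proof.
move=> hnb h xy; have ox := h _ (connected_openl xy).
move: y xy; apply: (connected_ind (Q := fun y => conn w' B (phi x) (phi y))).
  exact: connected_refl.
by move=> a b _ xa ab ob; apply: connected_step xa (hnb _ _ ab) (h _ ob).
Qed.

Lemma Pr_map p s E (phi psi : site d -> site d) : cancel phi psi -> cancel psi phi ->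
  Pr p (map phi s) E = Pr p s (fun u => E (u \o psi)).
Proof.
move=> c1 c2; rewrite /Pr -[fun=> false]/((fun=> false) \o psi).
by rewrite (Ex_map _ _ _ _ c1 c2).
Qed.

Record lattice_symmetry (phi psi : site d -> site d) : Prop := LatticeSymmetry {
  symK : cancel phi psi;
  symVK : cancel psi phi;
  sym_nb : forall a b, nb (phi a) (phi b) = nb a b;
  sym_box : forall c n z, box (phi c) n (phi z) <-> box c n z }.

Lemma Pr_sym p c n E phi psi : lattice_symmetry phi psi ->
  Pr p (bx (phi c) n) E = Pr p (bx c n) (fun u => E (u \o psi)).
Proof.
move=> [c1 c2 _ hbox]; rewrite -(Pr_map _ _ _ c1 c2).
apply: Ex_perm; apply: uniq_perm; first exact: bx_uniq.
  by rewrite map_inj_uniq ?bx_uniq//; exact: can_inj c1.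
move=> z; apply/idP/mapP => [/mem_bx|[u /mem_bx hu ->]].
  by rewrite -{1}(c2 z) => /hbox hz; exists (psi z); [apply/mem_bx|rewrite c2].
by apply/mem_bx/hbox.
Qed.

Lemma connected_symmetry phi psi w c n x y : lattice_symmetry phi psi ->
  conn (w \o psi) (box (phi c) n) (phi x) (phi y) <-> conn w (box c n) x y.
Proof.
move=> [c1 c2 hnb hbox]; split; last first.
  apply: connected_map => [a b|z [bz oz]]; first by rewrite hnb.
  by split; [apply/hbox|rewrite /= c1].
rewrite -{2}(c1 x) -{2}(c1 y); apply: connected_map => [a b|z [bz oz]].
  by move=> ab; rewrite -hnb !c2.
by split => //; apply/hbox; rewrite c2.
Qed.

Lemma Pr_connected_sym p c n x y phi psi : lattice_symmetry phi psi ->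
  Pr p (bx (phi c) n) (fun w => conn w (box (phi c) n) (phi x) (phi y)) =
  Pr p (bx c n) (fun w => conn w (box c n) x y).
Proof.
move=> h; rewrite (Pr_sym _ _ _ _ h); apply: eq_Ex => w.
by apply: indicator_congr; exact: connected_symmetry h.
Qed.

Lemma symmetry_boundary phi psi c n z : lattice_symmetry phi psi ->
  inner_boundary R (box (phi c) n) (phi z) <-> inner_boundary R (box c n) z.
Proof.
move=> [c1 c2 hnb hbox]; split => -[bz [y [nby zy]]].
  split; first exact/hbox.
  by exists (psi y); split; [rewrite -hbox c2|rewrite -hnb c2].
split; first exact/hbox.
by exists (phi y); split; [rewrite hbox|rewrite hnb].
Qed.

Lemma translation_symmetry c : lattice_symmetry (fun z => z + c) (fun z => z - c).
Proof.
split => [z|z|a b|b n z]; rewrite ?addrK ?subrK ?neighborD//.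
split => /boxP h; apply/boxP => i; have := h i; rewrite !siteD; lia.
Qed.

Lemma Pr_two_arms_translate p c n :
  Pr p (bx c n) (two_arms R c n) = Pr p (bx 0 n) (two_arms R (0 : site d) n).
Proof.
have h := translation_symmetry c.
rewrite -{1 2}(add0r c) (Pr_sym p 0 n _ h) /=; apply: eq_Ex => w.
apply: indicator_congr; rewrite !two_armsP.
split=> [[y [z [a [b [[xy xz] nyz [ya ba] [zb bb]]]]]]|].
  have e u : u = (u - c) + c by rewrite subrK.
  rewrite (e y) in xy nyz ya; rewrite (e z) in xz nyz zb.
  rewrite (e a) in ya ba; rewrite (e b) in zb bb.
  exists (y - c), (z - c), (a - c), (b - c); split.
  - by split; [rewrite neighborD in xy|rewrite neighborD in xz].
  - by move=> /(connected_symmetry w 0 n _ _ h).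
  - by split; [apply/(connected_symmetry w 0 n _ _ h)|apply/(symmetry_boundary 0 n _ h)].
  - by split; [apply/(connected_symmetry w 0 n _ _ h)|apply/(symmetry_boundary 0 n _ h)].
move=> [y [z [a [b [[xy xz] nyz [ya ba] [zb bb]]]]]].
exists (y + c), (z + c), (a + c), (b + c); split.
- by split; rewrite neighborD.
- by move=> /(connected_symmetry w 0 n _ _ h).
- by split; [apply/(connected_symmetry w 0 n _ _ h)|apply/(symmetry_boundary 0 n _ h)].
- by split; [apply/(connected_symmetry w 0 n _ _ h)|apply/(symmetry_boundary 0 n _ h)].
Qed.

End Invariance.

(** * A finite-size criterion at the critical point *)

Section Criterion.
Variables (R : realType) (d : nat).
Implicit Types (x y z c : site d) (w v : configuration d) (p : R).

Local Notation nb := (@neighbor R d).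
Local Notation conn := (@connected_in R d).

Definition reach c m w :=
  exists2 b, inner_boundary R (box c m) b & conn w (box c m) c b.

Definition bd c n : seq (site d) := [seq x <- bx c n | `[< inner_boundary R (box c n) x >]].

Lemma mem_bd c n x : (x \in bd c n) <-> inner_boundary R (box c n) x.
Proof.
rewrite mem_filter; split => [/andP[/asboolP//]|h].
by apply/andP; split; [apply/asboolP|apply/mem_bx; case: h].
Qed.

Definition two_point p n x := Pr p (bx 0 n) (fun w => conn w (box 0 n) 0 x).

(** An upper bound for the expected number of edges through which the cluster of
    the origin in [Lambda(n)] can be left. *)
Definition Phi p n := \sum_(x <- bd 0 n) \sum_(y <- nbrs x) two_point p n x.

Lemma PhiE p n : Phi p n = (2 * d)%:R * \sum_(x <- bd 0 n) two_point p n x.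
Proof.
rewrite mulr_sumr; apply: eq_bigr => x _.
by rewrite big_const_seq count_predT size_nbrs iter_addr_0 mulr_natl.
Qed.

Definition one_arm p m := Pr p (bx 0 m) (reach (0 : site d) m).

Lemma reach_depends c m : depends_on (box c m) (fun w => `[< reach c m w >]).
Proof.
suff h w w' : (forall z, box c m z -> w z = w' z) -> reach c m w -> reach c m w'.
  by move=> w w' ww'; apply/asboolP/asboolP; apply: h => // z /ww' ->.
move=> ww' [b bb cb]; exists b => //.
by apply: connected_in_congr cb.
Qed.

Lemma Pr_reach_translate p c m : Pr p (bx c m) (reach c m) = one_arm p m.
Proof.
have h := translation_symmetry R c.
rewrite -{1 2}(add0r c) (Pr_sym p 0 m _ h) /=; apply: eq_Ex => w.
apply: indicator_congr.
split=> [[b bb cb]|[b bb cb]].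
  rewrite -(subrK c b) in bb cb; exists (b - c).
    exact/(symmetry_boundary 0 m _ h).
  exact/(connected_symmetry w 0 m _ _ h).
exists (b + c); first exact/(symmetry_boundary 0 m _ h).
exact/(connected_symmetry w 0 m _ _ h).
Qed.

(** Follow a long arm backwards until it first meets the cluster of the origin
    in the small box: what precedes is an arm of the outside that avoids
    everything explored, hence independent of it. *)
Lemma one_arm_sub p n m : 0 <= p <= 1 ->
  one_arm p (n + m + 2) <= Phi p n * one_arm p m.
Proof.
move=> hp; have hP := @is_prob_const R (site d) p hp.
pose A w := explored R (box 0 n) w 0.
pose s : seq (site d) := bx 0 (n + m + 2).
pose V w := [seq x <- s | A w x].
have sub : box (0 : site d) n `<=` box 0 (n + m + 2) by apply: box_sub => i; lia.
have As w x : A w x -> x \in s by move=> /asboolP[/sub/mem_bx].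
pose F x w : R := `[< conn w (box 0 n) 0 x >]%:R.
pose far y B w := exists2 b, inner_boundary R (box y m) b &
  conn w (box y m `\` [set z | z \in (B : seq (site d))]) y b.
pose G y B w : R := `[< far y B w >]%:R.
have key w : reach 0 (n + m + 2) w ->
    exists2 x, x \in bd 0 n & exists2 y, y \in nbrs x & conn w (box 0 n) 0 x /\ far y (V w) w.
  move=> [b bb cb]; have o0 : open_in w (box 0 n) 0.
    by split; [exact: box_center|have [] := connected_openl cb].
  have VA z : (z \in V w) = A w z.
    by rewrite mem_filter; case: (boolP (A w z)) => //= /As ->.
  have [i hi] : exists i, b ord0 i = (n + m + 2)%:Z \/ b ord0 i = - (n + m + 2)%:Z.
    have /inner_boundaryP[_ [i hi]] := bb; exists i.
    by move: hi; rewrite mxE add0r sub0r.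
  have nVb : b \notin V w.
    by rewrite VA; apply/negP => /asboolP[/boxP/(_ i)]; rewrite mxE; lia.
  have V0 : 0 \in V w.
    by rewrite VA; apply/asboolP; split; [exact: box_center|left].
  have nQ0 : ~ [set z | z \notin V w] 0 by move=> /=; rewrite V0.
  have [y [x [by_ yx [_ wx] nx]]] := connected_exit (connected_sym cb)
    (nVb : [set z | z \notin V w] b) nQ0.
  have Ax : A w x by rewrite -VA; apply/negPn/negP.
  have cx : conn w (box 0 n) 0 x by exact: explored_open.
  have [bx0 _] := connected_openr cx.
  have [[_ Vy] wy] := connected_openr by_.
  (* otherwise [y], being open and adjacent to the cluster, would be explored *)
  have nby : ~ box 0 n y.
    move=> bny; move: Vy => /=; rewrite VA => /negP; apply; apply: connected_explored.
    by apply: (connected_step cx); rewrite 1?neighbor_sym.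
  exists x; first by apply/mem_bd; split => //; exists y; rewrite neighbor_sym.
  exists y; first by rewrite (mem_nbrs R) neighbor_sym.
  split => //.
  have nyb : ~ box y m b.
    move=> /boxP/(_ i); have /boxP/(_ i) := bx0; rewrite mxE.
    have := neighbor_dist i yx; lia.
  have [a ba ya] := connected_boundary (connected_sym by_) (box_center y m) nyb.
  exists a => //; apply: connected_mono ya => z [[[_ Qz] bz] oz].
  by split => //; split => //; apply/negP.
rewrite /one_arm -/s -(@Pr_marginal R d p s s _ (fun=> false))//; last 3 first.
- exact: bx_uniq.
- exact: bx_uniq.
- exact: depends_on_bx (@reach_depends 0 _).
apply: (@le_trans _ _ (\sum_(x <- bd 0 n) \sum_(y <- [seq y <- nbrs x | `[< box 0 (n + 1) y >]])
    Ex (fun=> p) s (fun w => F x w * G y (V w) w) (fun=> false))).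
  under eq_bigr do rewrite -Ex_sum.
  rewrite -Ex_sum; apply: le_Ex => // w; case: asboolP => [/key[x xb [y yx [cx fy]]]|_]; last first.
    by apply: sumr_ge0 => x _; apply: sumr_ge0 => y _; rewrite mulr_ge0 ?ler0n.
  have by_ : box 0 (n + 1) y.
    apply/boxP => i; move: yx; rewrite (mem_nbrs R) => /(neighbor_dist i).
    by have /mem_bd[/boxP/(_ i)] := xb; rewrite mxE; lia.
  have yx' : y \in [seq y <- nbrs x | `[< box 0 (n + 1) y >]].
    by rewrite mem_filter yx asboolT.
  have FG0 x' y' : 0 <= F x' w * G y' (V w) w by rewrite mulr_ge0 ?ler0n.
  have <- : F x w * G y (V w) w = true%:R by rewrite /F /G !asboolT// mulr1.
  apply: (le_trans (ler_term_sum yx' (FG0 x))).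
  apply: (@ler_term_sum R _ _ _ (fun x => \sum_(y <- [seq y <- nbrs x | `[< box 0 (n + 1) y >]])
      F x w * G y (V w) w)) => // x'.
  exact: sumr_ge0.
rewrite /Phi mulr_suml; apply: ler_sum => x _; rewrite mulr_suml.
apply: (@le_trans _ _ (\sum_(y <- nbrs x | `[< box 0 (n + 1) y >])
    (two_point p n x * one_arm p m))).
  rewrite big_filter; apply: ler_sum => y /asboolP by_.
  have sub' : box y m `<=` box 0 (n + m + 2).
    by apply: box_sub => i; have /boxP/(_ i) := by_; rewrite mxE; lia.
  have -> : two_point p n x = Ex (fun=> p) s (F x) (fun=> false).
    rewrite /two_point; apply/esym/Pr_marginal; [exact: bx_uniq|exact: bx_uniq|exact: sub_bx|].
    exact/depends_on_bx/connected_depends.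
  apply: Ex_stopping_indep => //.
  - exact: bx_uniq.
  - exact: explored_stopping.
  - move=> w w' ww'; rewrite /F; apply: indicator_congr.
    exact: connected_stopping.
  - move=> B w w' ww'; rewrite /G; apply: indicator_congr.
    by split=> -[b bb cb]; exists b => //; apply: connected_in_congr cb => z [_ /negP/ww' ->].
  - move=> B; rewrite -(Pr_reach_translate p y m).
    rewrite -(@Pr_marginal R d p (bx y m) s _ (fun=> false)); last 4 first.
    + exact: bx_uniq.
    + exact: bx_uniq.
    + exact: sub_bx.
    + exact: depends_on_bx (@reach_depends y m).
    apply: le_Ex => // w; apply: ler_indicator => -[b bb cb]; exists b => //.
    by apply: connected_mono cb => z [[]].
rewrite [leRHS](bigID (fun y => `[< box 0 (n + 1) y >])) /= lerDl sumr_ge0// => y _.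
by rewrite mulr_ge0// Pr_ge0.
Qed.

Lemma one_arm_exp p n k : 0 <= p <= 1 -> one_arm p (k * (n + 2)) <= Phi p n ^+ k.
Proof.
move=> hp; elim: k => [|k IH]; first by rewrite expr0; exact: Pr_le1.
have P0 : 0 <= Phi p n by apply: sumr_ge0 => x _; apply: sumr_ge0 => y _; exact: Pr_ge0.
rewrite (_ : (k.+1 * (n + 2) = n + k * (n + 2) + 2)%N); last by lia.
by rewrite (le_trans (one_arm_sub _ _ hp))// exprS ler_wpM2l.
Qed.

(** This writes percolation as a countable intersection of finite-range events,
    which makes it measurable. *)
Lemma infinite_cluster_reach w :
  infinite_set (Defs.cluster R w setT 0) <-> forall m, reach 0 m w.
Proof.
split => [inf m|h fin].
  have [y cy nby] : exists2 y, Defs.cluster R w setT 0 y & ~ box 0 m y.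
    apply: contrapT => H; apply: inf; apply: (@sub_finite_set _ _ [set` bx 0 m]).
      move=> y cy; apply/mem_bx; apply: contrapT => nby; apply: H; by exists y.
    exact: finite_seq.
  have [a ba ca] := connected_boundary cy (box_center 0 m) nby.
  by exists a => //; apply: connected_mono ca => z [[]].
move: fin => /finite_seqP[s sE].
pose M := (\sum_(x <- s) \sum_(i < d) `|x ord0 i|)%N.
have [b /inner_boundaryP[_ [i hi]] cb] := h M.+1.
have bs : b \in s.
  suff : [set` s] b by [].
  by rewrite -sE; apply: connected_mono cb => z [].
have : (`|b ord0 i| <= M)%N.
  rewrite /M (perm_big _ (perm_to_rem bs)) big_cons /= (bigD1 i)//=.
  by rewrite -addnA leq_addr.
by move: hi; rewrite mxE; lia.
Qed.

Variables (P : R -> probability (configurations d) R) (hP : site_percolation P).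

(** The one-arm probability decays geometrically along multiples of [n + 2]. *)
Lemma theta_eq0 p n : 0 <= p <= 1 -> Phi p n < 1 -> theta P p = 0%E.
Proof.
move=> hp Phi1; have P0 : 0 <= Phi p n.
  by apply: sumr_ge0 => x _; apply: sumr_ge0 => y _; exact: Pr_ge0.
have hr m := @percolation_Pr R d P hP p (bx 0 m) (reach 0 m) hp (bx_uniq _ _)
  (depends_on_bx (@reach_depends 0 m)).
have e : [set w : configuration d | infinite_set (Defs.cluster R w setT 0)] =
    \bigcap_m [set w | reach 0 m w].
  apply/seteqP; split => w /=.
    by move=> /infinite_cluster_reach h m _; exact: h.
  by move=> h; apply/infinite_cluster_reach => m; exact: h.
have mI : measurable (\bigcap_m [set w | reach 0 m w] : set (configurations d)).
  by apply: bigcapT_measurable => m; exact: (hr m).1.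
have bound k : (theta P p <= (Phi p n ^+ k)%:E)%E.
  rewrite /theta e (@le_trans _ _ (P p [set w | reach 0 (k * (n + 2)) w]))//.
    apply: le_measure; rewrite ?inE//; first exact: (hr _).1.
    by move=> w; apply.
  by rewrite (hr _).2 lee_fin one_arm_exp.
apply/eqP; rewrite eq_le measure_ge0 andbT.
apply/lee_addgt0Pr => eps eps0; rewrite add0e.
have Phi1' : `|Phi p n| < 1 by rewrite ger0_norm.
have [k _ hk] := cvgr_lt _ (cvg_expr Phi1') eps eps0.
by rewrite (le_trans (bound k))// lee_fin ltW// hk /=.
Qed.

Lemma Ex_continuous s (F : configuration d -> R) w :
  continuous (fun p : R => Ex (fun=> p) s F w).
Proof.
elim: s w => [|x s IH] w p /=; first exact: cvg_cst.
apply: cvgD; apply: cvgM; [exact: cvg_id|exact: IH| |exact: IH].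
by apply: cvgB; [exact: cvg_cst|exact: cvg_id].
Qed.

Lemma Phi_continuous n : continuous (fun p : R => Phi p n).
Proof.
move=> p; rewrite /Phi.
have h x : {for p, continuous (fun p : R => two_point p n x)} by exact: Ex_continuous.
apply: cvg_big => [|x _]; first exact: add_continuous.
apply: cvg_big => [|y _]; [exact: add_continuous|exact: h].
Qed.

Lemma critical_probability_itv : 0 <= critical_probability P <= 1.
Proof.
rewrite /critical_probability; set S := [set p | _].
have [->|/set0P[p Sp]] := eqVneq S set0; first by rewrite sup0 lexx ler01.
have ub : has_ubound S by exists 1 => q [/andP[]].
have /andP[p0 _] := Sp.1.
rewrite (le_trans p0)/=; last exact: ub_le_sup.
by apply: ge_sup; [exists p|move=> q [/andP[]]].
Qed.

(** Otherwise the finite-size criterion would still hold slightly above the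
    critical point, and there would be no percolation there. *)
Lemma critical_Phi n : critical_probability P < 1 -> 1 <= Phi (critical_probability P) n.
Proof.
set pc := critical_probability P => pc1; rewrite leNgt; apply/negP => Phi1.
have /andP[pc0 _] := critical_probability_itv; rewrite -/pc in pc0.
have near_pc : nbhs pc [set q | Phi q n < 1].
  exact: cvgr_lt _ (@Phi_continuous n pc) 1 Phi1.
move: near_pc => /nbhs_ballP[e /= e0 he].
(* strictly above [pc], within the radius of continuity, and at most 1 *)
pose q := pc + Num.min (e / 2) (1 - pc).
have m0 : 0 < Num.min (e / 2) (1 - pc) by rewrite lt_min divr_gt0// subr_gt0.
have mle : Num.min (e / 2) (1 - pc) <= e / 2 by rewrite ge_min lexx.
have mle' : Num.min (e / 2) (1 - pc) <= 1 - pc by rewrite ge_min lexx orbT.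
have pq : pc < q by rewrite ltrDl.
have hq : 0 <= q <= 1 by rewrite /q; lra.
have q1 : Phi q n < 1.
  apply: he; rewrite /ball /= distrC /q addrAC subrr add0r gtr0_norm//.
  by rewrite (le_lt_trans mle)// ltr_pdivrMr// ltr_pMr// ltr1n.
have : q <= pc.
  apply: ub_le_sup; first by exists 1 => r [/andP[]].
  by split => //; exact: theta_eq0 q1.
by rewrite leNgt pq.
Qed.

End Criterion.

(** * Polynomial lower bound for connections inside a box *)

Section BoxConnection.
Variables (R : realType) (d : nat).
Implicit Types (x y z u v c : site d) (w : configuration d) (p : R).

Local Notation nb := (@neighbor R d).
Local Notation conn := (@connected_in R d).

Definition reflection (j : 'I_d) (a : int) x : site d :=
  \row_i (if i == j then a - x ord0 i else x ord0 i).

Lemma reflectionE j a x i :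
  reflection j a x ord0 i = (if i == j then a - x ord0 i else x ord0 i) :> int.
Proof. by rewrite mxE. Qed.

Lemma reflection_symmetry j a : lattice_symmetry R (reflection j a) (reflection j a).
Proof.
have K : cancel (reflection j a) (reflection j a).
  by move=> x; apply: site_eq => i; rewrite !reflectionE; case: eqP => // _; lia.
split => // [x y|c n x].
  rewrite !neighborE; congr (_ == _); apply: eq_bigr => i _; rewrite !reflectionE.
  by case: eqP => // _; rewrite -sqrrN; congr (_ ^+ 2); lia.
by split=> /boxP h; apply/boxP => i; have := h i; rewrite !reflectionE; case: eqP => // _; lia.
Qed.

Definition coord_swap (i j : 'I_d) x : site d := \row_k x ord0 (tperm i j k).

Lemma coord_swapE i j x k : coord_swap i j x ord0 k = x ord0 (tperm i j k) :> int.
Proof. by rewrite mxE. Qed.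

Lemma coord_swap_symmetry i j : lattice_symmetry R (coord_swap i j) (coord_swap i j).
Proof.
have K : cancel (coord_swap i j) (coord_swap i j).
  by move=> x; apply: site_eq => k; rewrite !coord_swapE tpermK.
split => // [x y|c n x].
  rewrite !neighborE; congr (_ == _).
  rewrite [RHS](reindex_inj (@perm_inj _ (tperm i j))) /=.
  by apply: eq_bigr => k _; rewrite !coord_swapE.
split=> /boxP h; apply/boxP => k; last by rewrite !coord_swapE; exact: h.
by have := h (tperm i j k); rewrite !coord_swapE tpermK.
Qed.

Lemma size_grid_face (l : 'I_d -> seq int) i m :
  (forall j, j != i -> (size (l j) <= m)%N) -> (size (l i) <= 1)%N ->
  (size (grid l) <= m ^ d.-1)%N.
Proof.
move=> hl hi; rewrite size_grid (bigD1 i)//=.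
apply: (@leq_trans (1 * \prod_(j < d | j != i) m)).
  by apply: leq_mul => //; apply: leq_prod.
by rewrite mul1n prod_nat_const cardC1 card_ord.
Qed.

Lemma size_flatten_faces (F : 'I_d -> bool -> seq (site d)) m :
  (forall i b, (size (F i b) <= m)%N) ->
  (size (flatten [seq F ib.1 ib.2 | ib : 'I_d * bool]) <= 2 * d * m)%N.
Proof.
move=> hF; rewrite size_flatten /shape -map_comp sumnE big_map.
apply: (@leq_trans (\sum_(ib <- enum {: 'I_d * bool}) m)).
  by apply: leq_sum => -[i b] _; exact: hF.
rewrite big_const_seq count_predT -cardE card_prod card_ord card_bool.
by rewrite iter_addn_0 mulnC (mulnC d).
Qed.

Definition face n (i : 'I_d) (b : bool) : seq (site d) :=
  grid (fun j => if j == i then [:: (-1) ^+ b * n%:Z] else interval_list (- n%:Z) (2 * n).+1).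

Lemma size_bd n : (size (bd R (0%R : site d) n) <= 2 * d * (2 * n).+1 ^ d.-1)%N.
Proof.
pose L := flatten [seq face n ib.1 ib.2 | ib : 'I_d * bool].
apply: (@leq_trans (size L)).
  apply: uniq_leq_size; first by rewrite filter_uniq// bx_uniq.
  move=> x /mem_bd/inner_boundaryP[/boxP bx0 [i hi]].
  have [b hb] : exists b : bool, x ord0 i = (-1) ^+ b * n%:Z.
    by case: hi; rewrite mxE => ->; [exists false|exists true]; rewrite ?expr0 ?expr1; lia.
  apply/flatten_mapP; exists (i, b); first by rewrite mem_enum.
  rewrite mem_grid; apply/forallP => j /=; case: eqP => [->|_].
    by rewrite inE hb.
  by rewrite mem_interval_list; have := bx0 j; rewrite mxE; lia.
apply: size_flatten_faces => i b; apply: (@size_grid_face _ i) => [j ji|].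
  by rewrite (negbTE ji) size_interval_list.
by rewrite eqxx.
Qed.

(** Half of the share of [Phi] that falls on average to one boundary site; the
    other half makes the pigeonhole inequality strict. *)
Definition face_bound n : R := (8 * d%:R ^+ 2 * (2 * n).+1%:R ^+ d.-1)^-1.

Lemma face_bound_gt0 n : (0 < d)%N -> 0 < face_bound n.
Proof.
by move=> d0; rewrite invr_gt0 !mulr_gt0 ?exprn_gt0 ?ltr0n.
Qed.

Lemma face_bound_anti n m : (0 < d)%N -> (n <= m)%N -> face_bound m <= face_bound n.
Proof.
move=> d0 nm; rewrite lef_pV2 ?posrE; last 2 first.
- by rewrite -invr_gt0; exact: face_bound_gt0.
- by rewrite -invr_gt0; exact: face_bound_gt0.
rewrite ler_wpM2l ?mulr_ge0 ?exprn_ge0//.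
by rewrite lerXn2r ?nnegrE ?ler0n// ler_nat; lia.
Qed.

Lemma face_bound_le1 n : (0 < d)%N -> face_bound n <= 1.
Proof.
move=> d0; rewrite invf_le1; last by rewrite -invr_gt0; exact: face_bound_gt0.
have h1 : 1 <= d%:R ^+ 2 :> R by rewrite exprn_ege1// ler1n.
have h2 : 1 <= (2 * n).+1%:R ^+ d.-1 :> R by rewrite exprn_ege1// ler1n.
have h3 : 1 <= 8 * d%:R ^+ 2 :> R.
  by rewrite (le_trans h1)// ler_peMl ?exprn_ge0// ler1n.
by rewrite (le_trans h3)// ler_peMr// (le_trans _ h3).
Qed.

Variable (p : R).
Hypotheses (hp : 0 <= p <= 1) (d0 : (0 < d)%N).

Lemma exists_two_point n : 1 <= Phi d p n ->
  exists2 x : site d, x \in bd R 0 n & face_bound n <= two_point p n x.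
Proof.
move=> h; apply: contrapT => H.
have le x : x \in bd R 0 n -> two_point p n x <= face_bound n.
  by move=> xb; rewrite leNgt; apply/negP => lt; apply: H; exists x => //; exact: ltW.
have : Phi d p n <= 1 / 2.
  rewrite PhiE; apply: (@le_trans _ _
    ((2 * d)%:R * ((2 * d * (2 * n).+1 ^ d.-1)%:R * face_bound n))).
    rewrite ler_wpM2l ?ler0n//.
    apply: (@le_trans _ _ (\sum_(x <- bd R (0 : site d) n) face_bound n)).
      by rewrite big_seq [leRHS]big_seq; apply: ler_sum.
    rewrite big_const_seq count_predT iter_addr_0 -[leLHS]mulr_natl ler_wpM2r//.
      exact/ltW/face_bound_gt0.
    by rewrite ler_nat size_bd.
  rewrite /face_bound !natrM natrX.
  have a0 : (d%:R : R) != 0 by rewrite pnatr_eq0 -lt0n.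
  have b0 : ((2 * n).+1%:R ^+ d.-1 : R) != 0 by rewrite expf_neq0// pnatr_eq0.
  set b := _ ^+ d.-1 in b0 *; set a := d%:R in a0 *.
  rewrite [leLHS](_ : _ = 1 / 2)//; field.
  by rewrite a0 b0.
by move: h; lra.
Qed.

Lemma two_point_sym n x phi psi : lattice_symmetry R phi psi -> phi 0 = 0 ->
  two_point p n (phi x) = two_point p n x.
Proof.
by move=> h h0; have := Pr_connected_sym p 0 n 0 x h; rewrite h0.
Qed.

(** A coordinate swap and a reflection, both of which fix the origin, move a
    good boundary site to any prescribed face. *)
Lemma exists_two_point_dir n (j : 'I_d) : 1 <= Phi d p n ->
  exists2 x : site d, x ord0 j = n%:Z & face_bound n <= two_point p n x.
Proof.
move=> /exists_two_point[x /mem_bd/inner_boundaryP[_ [i hi]] hx].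
have h1 := coord_swap_symmetry i j; have h2 := reflection_symmetry j 0.
have e1 : coord_swap i j 0 = 0 by apply: site_eq => k; rewrite coord_swapE !mxE.
have e2 : reflection j 0 0 = 0.
  by apply: site_eq => k; rewrite reflectionE !mxE; case: eqP.
rewrite -(two_point_sym n x h1 e1) in hx; rewrite mxE in hi.
have hj : coord_swap i j x ord0 j = x ord0 i by rewrite coord_swapE tpermR.
case: hi => hi; first by exists (coord_swap i j x) => //; rewrite hj hi; lia.
exists (reflection j 0 (coord_swap i j x)); last by rewrite (two_point_sym _ _ h2 e2).
by rewrite reflectionE eqxx hj hi; lia.
Qed.

Lemma connected_increasing A x y : increasing (fun w => `[< conn w A x y >]%:R : R).
Proof.
move=> w w' ww'; apply: ler_indicator; apply: connected_mono => z [Az oz].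
by split => //; exact: ww'.
Qed.

Lemma Pr_glue s A x y z :
  Pr p s (fun w => conn w A x y) * Pr p s (fun w => conn w A y z) <=
  Pr p s (fun w => conn w A x z).
Proof.
apply: le_trans (Harris s (fun=> false) (is_prob_const hp)
  (@connected_increasing A x y) (@connected_increasing A y z)) _.
apply: le_Ex; first exact: is_prob_const.
move=> w; case: asboolP => [xy|_]; last by rewrite mul0r ler0n.
case: asboolP => [yz|_]; last by rewrite mulr0 ler0n.
by rewrite mulr1 asboolT//; exact: connected_trans yz.
Qed.

Lemma Pr_connectedC s A x y :
  Pr p s (fun w => conn w A x y) = Pr p s (fun w => conn w A y x).
Proof. by apply: eq_Ex => w; apply: indicator_congr; split; exact: connected_sym. Qed.

Lemma Pr_connected_sub c n c' m x y : box c n `<=` box c' m ->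
  Pr p (bx c n) (fun w => conn w (box c n) x y) <=
  Pr p (bx c' m) (fun w => conn w (box c' m) x y).
Proof.
move=> sub; rewrite -(@Pr_marginal R d p (bx c n) (bx c' m) _ (fun=> false)); last 4 first.
- exact: bx_uniq.
- exact: bx_uniq.
- exact: sub_bx.
- exact/depends_on_bx/connected_depends.
by apply: le_Pr => // w; apply: connected_mono => z [/sub].
Qed.

Lemma Pr_open s x : uniq s -> x \in s -> Pr p s (fun w => w x) = p.
Proof.
move=> us xs.
rewrite [LHS](@Pr_marginal R d p [:: x] s (fun w => w x) (fun=> false))//=; last 2 first.
- by move=> y; rewrite inE => /eqP ->.
- by move=> w w' ww'; rewrite ww'// mem_head.
by rewrite /Pr /= !upd_same !asboolb /= mulr1 mulr0 addr0.
Qed.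

Lemma Pr_connected_refl c n x : box c n x ->
  Pr p (bx c n) (fun w => conn w (box c n) x x) = p.
Proof.
move=> bx_; rewrite -[RHS](@Pr_open (bx c n) x) ?bx_uniq//; last exact/mem_bx.
apply: eq_Ex => w; apply: indicator_congr.
by split=> [/connected_openl[]//|wx]; exact: connected_refl.
Qed.

Lemma Pr_connected_neighbor c n x y : box c n x -> box c n y -> nb x y ->
  p ^+ 2 <= Pr p (bx c n) (fun w => conn w (box c n) x y).
Proof.
move=> bx_ by_ xy.
have inc z : increasing (fun w : configuration d => `[< w z >]%:R : R).
  by move=> w w' ww'; apply: ler_indicator; exact: ww'.
have -> : p ^+ 2 = Pr p (bx c n) (fun w => w x) * Pr p (bx c n) (fun w => w y).
  by rewrite !Pr_open ?bx_uniq//; exact/mem_bx.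
apply: le_trans (Harris _ (fun=> false) (is_prob_const hp) (inc x) (inc y)) _.
apply: le_Ex; first exact: is_prob_const.
move=> w; case: asboolP => [wx|_]; last by rewrite mul0r ler0n.
case: asboolP => [wy|_]; last by rewrite mulr0 ler0n.
rewrite mulr1 asboolT//.
have cx : conn w (box c n) x x by exact: connected_refl.
exact: (connected_step cx xy).
Qed.

Hypothesis crit : forall n, 1 <= Phi d p n.

Definition axis_shift (j : 'I_d) (a : int) x : site d :=
  \row_i (if i == j then x ord0 i + a else x ord0 i).

Lemma axis_shiftE j a x i :
  axis_shift j a x ord0 i = (if i == j then x ord0 i + a else x ord0 i) :> int.
Proof. by rewrite mxE. Qed.

(** Connect [u] to the face orthogonal to the [j]-axis of the box of radius
    [k], and glue to this connection its mirror image through that face. *)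
Lemma Pr_connected_double c m u j k : box u k `<=` box c m ->
  box (axis_shift j (2 * k)%:Z u) k `<=` box c m ->
  face_bound k ^+ 2 <=
  Pr p (bx c m) (fun w => conn w (box c m) u (axis_shift j (2 * k)%:Z u)).
Proof.
move=> sub1 sub2; have [x xj hx] := exists_two_point_dir j (crit k).
have hT := translation_symmetry R u.
pose a := 2 * (u ord0 j + k%:Z).
have hS := reflection_symmetry j a.
have eu : reflection j a u = axis_shift j (2 * k)%:Z u.
  by apply: site_eq => i; rewrite reflectionE axis_shiftE; case: eqP => [->|//]; rewrite /a; lia.
have ex : reflection j a (x + u) = x + u.
  apply: site_eq => i; rewrite reflectionE siteD; case: eqP => [->|//]; rewrite xj /a; lia.
have h1 : face_bound k <= Pr p (bx u k) (fun w => conn w (box u k) u (x + u)).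
  by have := Pr_connected_sym p 0 k 0 x hT; rewrite add0r => ->.
have h2 : face_bound k <= Pr p (bx c m) (fun w => conn w (box c m) u (x + u)).
  exact: le_trans h1 (Pr_connected_sub _ _ sub1).
have h3 : face_bound k <= Pr p (bx c m)
    (fun w => conn w (box c m) (x + u) (axis_shift j (2 * k)%:Z u)).
  rewrite Pr_connectedC; apply: le_trans (Pr_connected_sub _ _ sub2).
  by rewrite -eu -ex (Pr_connected_sym _ _ _ _ _ hS).
have f0 := ltW (face_bound_gt0 k d0).
by apply: le_trans (Pr_glue _ _ _ (x + u) _); rewrite expr2 ler_pM.
Qed.

(** One factor [face_bound] for each half of a doubled step, and powers of [p]
    for a doubled step of length zero and for a last single step. *)
Definition line_bound n : R := p ^+ 3 * face_bound n ^+ 2.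

Lemma line_bound_ge0 n : 0 <= line_bound n.
Proof.
have /andP[p0 _] := hp.
by rewrite mulr_ge0 ?exprn_ge0//; exact/ltW/face_bound_gt0.
Qed.

(** A displacement [D] is a doubled step of length [2 * D./2], followed by one
    lattice step when [D] is odd. *)
Lemma Pr_connected_axis c n u j (D : nat) : box c n u ->
  box c n (axis_shift j D%:Z u) ->
  line_bound n <=
  Pr p (bx c (2 * n)) (fun w => conn w (box c (2 * n)) u (axis_shift j D%:Z u)).
Proof.
move=> bu bv; have /andP[p0 p1] := hp; pose k := D./2.
have DE : D = (odd D + 2 * k)%N by rewrite mul2n odd_double_half.
have kn : (k <= n)%N.
  move/boxP: bu => /(_ j); move/boxP: bv => /(_ j); rewrite axis_shiftE eqxx.
  by rewrite DE; lia.
pose v := axis_shift j (2 * k)%:Z u.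
have bv' : box c n v.
  apply/boxP => i; move/boxP: bu => /(_ i); move/boxP: bv => /(_ i).
  by rewrite !axis_shiftE; case: eqP => // _; rewrite DE; lia.
have sub : box c n `<=` box c (2 * n) by apply: box_sub => i; lia.
have fk : face_bound n <= face_bound k by exact: face_bound_anti.
have f0 := face_bound_gt0 n d0; have f1 := face_bound_le1 n d0.
have f21 : face_bound n ^+ 2 <= 1 by rewrite exprn_ile1// ltW.
have f20 : 0 <= face_bound n ^+ 2 by rewrite exprn_ge0// ltW.
have h1 : p * face_bound n ^+ 2 <= Pr p (bx c (2 * n)) (fun w => conn w (box c (2 * n)) u v).
  have [k0|k0] := posnP k.
    have -> : v = u.
      by apply: site_eq => i; rewrite axis_shiftE k0; case: eqP => // _; lia.
    by rewrite Pr_connected_refl; [rewrite ler_piMr|exact: sub].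
  have sub1 : box u k `<=` box c (2 * n).
    by apply: box_sub => i; move/boxP: bu => /(_ i); lia.
  have sub2 : box v k `<=` box c (2 * n).
    by apply: box_sub => i; move/boxP: bv' => /(_ i); lia.
  apply: le_trans (Pr_connected_double sub1 sub2).
  rewrite (@le_trans _ _ (face_bound n ^+ 2)) ?ler_piMl//.
  by rewrite lerXn2r ?nnegrE ?(ltW f0) ?(le_trans (ltW f0)).
have h2 : p ^+ 2 <= Pr p (bx c (2 * n)) (fun w => conn w (box c (2 * n)) v (axis_shift j D%:Z u)).
  case oD : (odd D) in DE; last first.
    have -> : axis_shift j D%:Z u = v by rewrite /v DE add0n.
    by rewrite Pr_connected_refl; [rewrite expr2 ler_piMr|exact: sub].
  apply: Pr_connected_neighbor; [exact: sub|exact: sub|].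
  have -> : axis_shift j D%:Z u = v + (-1) ^+ false *: delta_mx ord0 j.
    apply: site_eq => i; rewrite site_stepE !axis_shiftE DE; case: eqP => _; lia.
  exact: neighbor_step.
apply: le_trans (Pr_glue _ _ _ v _).
rewrite [leLHS](_ : _ = (p * face_bound n ^+ 2) * p ^+ 2); last by rewrite /line_bound; ring.
by apply: ler_pM => //; [rewrite mulr_ge0|rewrite exprn_ge0].
Qed.

(** Two points of a box are connected, inside the box of twice the radius,
    with at least polynomial probability: move along one axis after another. *)
Lemma Pr_connected_box c n x y : box c n x -> box c n y ->
  p * line_bound n ^+ d <=
  Pr p (bx c (2 * n)) (fun w => conn w (box c (2 * n)) x y).
Proof.
move=> bx_ by_; pose z k : site d := \row_i (if (i < k)%N then y ord0 i else x ord0 i).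
have zE k i : z k ord0 i = (if (i < k)%N then y ord0 i else x ord0 i) :> int by rewrite mxE.
have bz k : box c n (z k).
  by apply/boxP => i; rewrite zE; case: ifP => _; [move/boxP: by_|move/boxP: bx_]; apply.
have sub : box c n `<=` box c (2 * n) by apply: box_sub => i; lia.
have -> : y = z d by apply: site_eq => i; rewrite zE ltn_ord.
suff h k : (k <= d)%N -> p * line_bound n ^+ k <=
    Pr p (bx c (2 * n)) (fun w => conn w (box c (2 * n)) x (z k)) by exact: h.
have /andP[p0 _] := hp; have l0 := line_bound_ge0 n.
elim: k => [_|k IH kd].
  have -> : z 0%N = x by apply: site_eq => i; rewrite zE.
  by rewrite Pr_connected_refl; [rewrite expr0 mulr1|exact: sub].
apply: le_trans (Pr_glue _ _ _ (z k) _).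
rewrite exprSr mulrA; apply: ler_pM => //; first by rewrite mulr_ge0// exprn_ge0.
  exact/IH/ltnW.
pose j := Ordinal kd.
have zz i : i != j -> z k.+1 ord0 i = z k ord0 i.
  by move=> ij; rewrite !zE ltnS leq_eqVlt -[k]/(val j) (inj_eq val_inj) (negbTE ij).
have [le|lt] := lerP (z k ord0 j) (z k.+1 ord0 j).
  have e : z k.+1 = axis_shift j `|z k.+1 ord0 j - z k ord0 j|%N%:Z (z k).
    apply: site_eq => i; rewrite axis_shiftE; case: eqP => [->|/eqP/zz//].
    by move: le; lia.
  by rewrite e; apply: Pr_connected_axis => //; rewrite -e.
have e : z k = axis_shift j `|z k.+1 ord0 j - z k ord0 j|%N%:Z (z k.+1).
  apply: site_eq => i; rewrite axis_shiftE; case: eqP => [->|/eqP/zz//].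
  by move: lt; lia.
by rewrite Pr_connectedC e; apply: Pr_connected_axis => //; rewrite -e.
Qed.

End BoxConnection.

(** * Two crossing clusters of an annulus are rare *)

Section TwoClusters.
Variables (R : realType) (d : nat).
Implicit Types (x y z c a b : site d) (w : configuration d).

Local Notation nb := (@neighbor R d).
Local Notation conn := (@connected_in R d).

Definition touches M w x :=
  exists2 b : site d, inner_boundary R (box 0 M) b & conn w (box 0 M) x b.

Definition separated M x y w :=
  [/\ touches M w x, touches M w y & ~ conn w (box 0 M) x y].

(** The way in which the arms are joined inside the box, recorded through the
    boundary sites where they end, so that the arms need no labels. *)
Definition boundary_links M w : site d -> site d -> Prop :=
  fun a b => [/\ inner_boundary R (box 0 M) a, inner_boundary R (box 0 M) b &
                 conn w (box 0 M) a b].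

Lemma separated_congr M x y w w' : (forall z, box 0 M z -> w z = w' z) ->
  separated M x y w -> separated M x y w'.
Proof.
move=> ww' [[a ba xa] [b bb yb] nxy]; split.
- by exists a => //; exact: connected_in_congr xa.
- by exists b => //; exact: connected_in_congr yb.
- by move=> xy; apply: nxy; apply: connected_in_congr xy => z /ww' ->.
Qed.

(** Only a site with two arms can change the links by its flip. *)
Lemma pivotal_two_arms M N z w : (0 < N)%N ->
  (forall i, `|z ord0 i| + N%:Z < M%:Z) ->
  boundary_links M (upd w z true) <> boundary_links M (upd w z false) ->
  two_arms R z N (upd w z false).
Proof.
move=> N0 zM; set w1 := upd w z true; set w0 := upd w z false => df.
have sub : box z N `<=` box 0 M.
  by apply: box_sub => i; have := zM i; rewrite mxE; lia.
have far a : inner_boundary R (box 0 M) a -> ~ box z N a.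
  move=> /inner_boundaryP[_ [i hi]] /boxP/(_ i).
  by have := zM i; move: hi; rewrite mxE; lia.
have le01 : le_conf w0 w1 by move=> u; rewrite /w0 /w1 /upd; case: eqP.
have [a [b [ba bb ab nab]]] : exists a b, [/\ inner_boundary R (box 0 M) a,
    inner_boundary R (box 0 M) b, conn w1 (box 0 M) a b & ~ conn w0 (box 0 M) a b].
  apply: contrapT => H; apply: df; apply/funext => a; apply/funext => b.
  apply/propext; split => -[ba bb ab]; split => //.
    by apply: contrapT => nab; apply: H; exists a, b.
  by apply: connected_mono ab => u [Au /le01].
have off A u v : conn w1 (A `&` [set t | t != z]) u v -> conn w0 A u v.
  apply: connected_mono => t [[At tz] ot]; split => //.
  by move: ot; rewrite /w1 /w0 !upd_other.
have nz u : inner_boundary R (box 0 M) u -> u != z.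
  by move=> /far h; apply/eqP => e; apply: h; rewrite e; exact: box_center.
have arm u v : inner_boundary R (box 0 M) u -> conn w1 (box 0 M) u v ->
    ~ conn w0 (box 0 M) u v -> exists2 u', nb z u' & conn w0 (box 0 M) u u'.
  move=> bu uv nuv; case: (connected_split uv (nz _ bu : [set t | t != z] u)) => [/off//|].
  move=> [u' [z' [uu' uz' _ /negP]]]; rewrite negbK => /eqP zz'.
  by exists u'; [rewrite neighbor_sym -zz'|exact: off uu'].
have [a' za' aa'] := arm _ _ ba ab nab.
have [b' zb' bb'] : exists2 b', nb z b' & conn w0 (box 0 M) b b'.
  apply: (arm _ a) => //; first exact: connected_sym.
  by move=> /connected_sym.
have [e be ae] := connected_boundary (connected_sym aa') (neighbor_box za' N0) (far _ ba).
have [f bf bf'] := connected_boundary (connected_sym bb') (neighbor_box zb' N0) (far _ bb).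
have drop u v : conn w0 (box 0 M `&` box z N) u v -> conn w0 (box z N) u v.
  by apply: connected_mono => t [[]].
apply/two_armsP; exists a', b', e, f; split.
- by split.
- move=> ab'; apply: nab; apply: connected_trans aa' _.
  apply: connected_trans (connected_sym bb').
  by apply: connected_mono ab' => t [/sub].
- by split; [exact: drop|].
- by split; [exact: drop|].
Qed.

Variable (p : R).
Hypotheses (p0 : 0 < p) (p1 : p < 1) (d0 : (0 < d)%N).
Hypothesis crit : forall n, 1 <= Phi d p n.

Definition alpha n : R := Pr p (bx 0 n) (two_arms R (0 : site d) n).

Definition link_bound n : R := p * line_bound d p n ^+ d.

Let hp : 0 <= p <= 1. Proof. by rewrite !ltW. Qed.
Let hP : is_prob (fun _ : site d => p). Proof. exact: is_prob_const. Qed.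

Lemma link_bound_gt0 n : 0 < link_bound n.
Proof.
rewrite mulr_gt0// exprn_gt0// mulr_gt0 ?exprn_gt0//.
exact: face_bound_gt0.
Qed.

(** The factor [1 - p] pays for closing [z], without which its arms would meet. *)
Lemma Ex_pivotal M N z w : (0 < N)%N ->
  (forall i, `|z ord0 i| + N%:Z < M%:Z) ->
  Ex (fun=> p) (bx 0 M) (fun w => `[< boundary_links M (upd w z true) <>
    boundary_links M (upd w z false) >]%:R) w <= alpha N / (1 - p).
Proof.
move=> N0 zM; rewrite ler_pdivlMr ?subr_gt0// mulrC.
have zS : z \in bx 0 M by apply/mem_bx/boxP => i; have := zM i; rewrite mxE; lia.
have sub : box z N `<=` box 0 M.
  by apply: box_sub => i; have := zM i; rewrite mxE; lia.
rewrite /alpha -(Pr_two_arms_translate p z).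
rewrite -(@Pr_marginal R d p (bx z N) (bx 0 M) _ w); last 4 first.
- exact: bx_uniq.
- exact: bx_uniq.
- exact: sub_bx.
- exact/depends_on_bx/two_arms_depends.
apply: le_trans (Ex_set0 w hP (bx_uniq _ _) zS _); last by move=> u; rewrite ler0n.
rewrite ler_wpM2l ?subr_ge0//; first exact: ltW.
by apply: le_Ex => // u; apply: ler_indicator; exact: pivotal_two_arms.
Qed.

(** Resample the box [c + Lambda(2 n)]. The links hardly ever change, so they
    are almost deterministic given the outside. If [x] and [y] are attached to
    two parts that these deterministic links separate, which is an increasing
    event, then by Harris they are also joined to one another inside the box
    with conditional probability at least [link_bound n], which changes the
    links. *)
Lemma Pr_separated M N c n x y : (0 < N)%N ->
  (forall i, `|c ord0 i| + (2 * n)%:Z + N%:Z < M%:Z) -> box c n x -> box c n y ->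
  Pr p (bx 0 M) (separated M x y) <=
  (1 + (link_bound n)^-1) * ((size (bx c (2 * n)))%:R * (alpha N / (1 - p))).
Proof.
move=> N0 cM bx_ by_; set r := bx c (2 * n).
have ur : uniq r by exact: bx_uniq.
have us : uniq (bx (0 : site d) M) by exact: bx_uniq.
have sub : box c (2 * n) `<=` box 0 M.
  by apply: box_sub => i; have := cM i; rewrite mxE; lia.
have rs : {subset r <= bx 0 M} := sub_bx sub.
pose piv z w : R := `[< boundary_links M (upd w z true) <> boundary_links M (upd w z false) >]%:R.
have v0 := link_bound_gt0 n; set v := link_bound n in v0 *.
have local w : Ex (fun=> p) r (fun w => `[< separated M x y w >]%:R) w <=
    (1 + v^-1) * \sum_(z <- r) Ex (fun=> p) r (piv z) w.
  have [g hg] := almost_constant (boundary_links M) w hP ur.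
  rewrite -/(piv _) in hg; set t := \sum_(z <- r) _ in hg *.
  pose W u := exists a b, [/\ inner_boundary R (box 0 M) a, inner_boundary R (box 0 M) b,
    conn u (box 0 M) x a, conn u (box 0 M) y b & ~ g a b].
  have Winc : increasing (fun u => `[< W u >]%:R : R).
    move=> u u' uu'; apply: ler_indicator => -[a [b [ba bb xa yb nab]]].
    by exists a, b; split => //; [apply: connected_mono xa|apply: connected_mono yb];
      move=> z [Az oz]; split => //; exact: uu'.
  (* [V] only looks at the resampled box, so its conditional probability does
     not depend on the outside [w] *)
  pose V u := conn u (box c (2 * n)) x y.
  have Vv : v <= Ex (fun=> p) r (fun u => `[< V u >]%:R) w.
    rewrite (Pr_marginal p w ur ur)//; last exact/depends_on_bx/connected_depends.
    exact: Pr_connected_box.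
  have hW : Ex (fun=> p) r (fun u => `[< W u >]%:R) w <= t / v.
    rewrite ler_pdivlMr//.
    have W0 : 0 <= Ex (fun=> p) r (fun u => `[< W u >]%:R) w by apply: Ex_ge0.
    apply: le_trans (ler_wpM2l W0 Vv) _.
    apply: le_trans (Harris _ _ hP Winc (@connected_increasing R d (box c (2 * n)) x y)) _.
    apply: le_trans hg; apply: le_Ex => // u.
    case: asboolP => [[a [b [ba bb xa yb nab]]]|_]; last by rewrite mul0r ler0n.
    rewrite mul1r; apply: ler_indicator => xy fg; apply: nab; rewrite -fg; split => //.
    apply: connected_trans (connected_sym xa) _; apply: connected_trans yb.
    by apply: connected_mono xy => z [/sub].
  apply: (@le_trans _ _ (t + t / v)); last by rewrite mulrDl mul1r (mulrC v^-1).
  apply: le_trans (lerD hg hW); rewrite -ExD; apply: le_Ex => // u.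
  case: asboolP => [[[a ba xa] [b bb yb] nxy]|_]; last by rewrite addr_ge0.
  (* when the links are the typical ones, [W] is what separation means *)
  have [fg|nfg] := pselect (boundary_links M u = g); last first.
    by rewrite (asboolT nfg) lerDl.
  have Wu : W u.
    exists a, b; split => //; rewrite -fg => -[_ _ ab]; apply: nxy.
    exact: connected_trans (connected_trans xa ab) (connected_sym yb).
  by rewrite (asboolT Wu) lerDr.
rewrite /Pr (Ex_tower _ _ _ ur us rs).
apply: le_trans (le_Ex _ _ hP local) _.
rewrite ExZ ler_wpM2l ?addr_ge0 ?invr_ge0 ?(ltW v0)//.
rewrite Ex_sum; under eq_bigr do rewrite -(Ex_tower _ _ _ ur us rs).
apply: (@le_trans _ _ (\sum_(z <- r) (alpha N / (1 - p)))).
  rewrite big_seq [leRHS]big_seq; apply: ler_sum => z /mem_bx/boxP zr.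
  by apply: Ex_pivotal => // i; have := cM i; have := zr i; lia.
by rewrite big_const_seq count_predT iter_addr_0 mulr_natl.
Qed.

End TwoClusters.

(** * Counting the crossing clusters *)

Section Counting.
Variables (R : realType) (d : nat).
Implicit Types (x y z c a b r : site d) (w : configuration d).

Local Notation nb := (@neighbor R d).
Local Notation conn := (@connected_in R d).

Lemma sum_indicatorE (I : Type) (s : seq I) (E : I -> Prop) :
  \sum_(i <- s) `[< E i >]%:R = (count (fun i => `[< E i >]) s)%:R :> R.
Proof.
by elim: s => [|i s IH]; rewrite ?big_nil// big_cons IH /= natrD.
Qed.

Lemma sum_indicator_image (I J : eqType) (s : seq I) (l : seq J) (f : J -> I)
    (E : I -> Prop) (F : J -> Prop) : uniq s ->
  (forall i, i \in s -> E i -> exists2 j, j \in l & F j /\ f j = i) ->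
  \sum_(i <- s) `[< E i >]%:R <= \sum_(j <- l) `[< F j >]%:R :> R.
Proof.
move=> us h; rewrite !sum_indicatorE ler_nat -!size_filter.
rewrite -(size_map f [seq j <- l | `[< F j >]]).
apply: uniq_leq_size; first by rewrite filter_uniq.
move=> i; rewrite mem_filter => /andP[/asboolP Ei si].
have [j jl [Fj <-]] := h i si Ei; apply: map_f.
by rewrite mem_filter jl asboolT.
Qed.

(** A canonical representative of the cluster of [x], so that clusters are
    counted by counting sites. *)
Definition rep M w x : site d :=
  head x [seq y <- bx 0 M | `[< conn w (box 0 M) x y >]].

Lemma rep_connected M w x y : conn w (box 0 M) x y -> rep M w x = rep M w y.
Proof.
move=> xy; have yy : y \in [seq z <- bx 0 M | `[< conn w (box 0 M) x z >]].
  by rewrite mem_filter asboolT//=; apply/mem_bx; case: (connected_openr xy).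
have e : [seq z <- bx 0 M | `[< conn w (box 0 M) x z >]] =
         [seq z <- bx 0 M | `[< conn w (box 0 M) y z >]].
  apply: eq_filter => z; apply: asbool_equiv_eq.
  by split; apply: connected_trans => //; exact: connected_sym.
by rewrite /rep -e; move: yy; case: [seq _ <- _ | _].
Qed.

Lemma connected_rep M w x : open_in w (box 0 M) x -> conn w (box 0 M) x (rep M w x).
Proof.
move=> ox; have xx : x \in [seq z <- bx 0 M | `[< conn w (box 0 M) x z >]].
  rewrite mem_filter asboolT/=; last exact: connected_refl.
  by apply/mem_bx; case: ox.
have : rep M w x \in [seq z <- bx 0 M | `[< conn w (box 0 M) x z >]].
  by rewrite /rep; move: xx; case: [seq _ <- _ | _] => //= a l _; rewrite mem_head.
by rewrite mem_filter => /andP[/asboolP].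
Qed.

Lemma rep_id M w x : open_in w (box 0 M) x -> rep M w (rep M w x) = rep M w x.
Proof. by move=> /connected_rep /rep_connected. Qed.

Definition crossing_rep M (A : set (site d)) w r :=
  [/\ rep M w r = r, touches R M w r & exists2 x, A x & conn w (box 0 M) r x].

(** The number of clusters of [Lambda(M)] that meet [A] and touch the boundary,
    each of them counted through its representative. *)
Definition crossing_number M (A : set (site d)) w : R :=
  \sum_(r <- bx 0 M) `[< crossing_rep M A w r >]%:R.

(** Fix one cluster that meets the small box; every other one supplies a pair of
    separated sites. *)
Lemma crossing_number_local M c n w :
  crossing_number M (box c n) w <=
  1 + \sum_(x <- bx c n) \sum_(y <- bx c n) `[< separated R M x y w >]%:R.
Proof.
have S0 : 0 <= \sum_(x <- bx c n) \sum_(y <- bx c n) `[< separated R M x y w >]%:R :> R.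
  by apply: sumr_ge0 => x _; apply: sumr_ge0.
have [[r0 [e0 t0 [x0 bx0 r0x0]]]|H] := pselect (exists r, crossing_rep M (box c n) w r); last first.
  rewrite /crossing_number big1 ?addr_ge0// => r _.
  by rewrite asboolF// => h; apply: H; exists r.
have tx0 : touches R M w x0.
  have [b bb r0b] := t0; exists b => //.
  exact: connected_trans (connected_sym r0x0) r0b.
apply: (@le_trans _ _ (\sum_(r <- bx 0 M) (`[< r = r0 >]%:R +
    `[< crossing_rep M (box c n) w r /\ r <> r0 >]%:R))).
  apply: ler_sum => r _; have [rr0|rr0] := pselect (r = r0).
    by rewrite (asboolT rr0) -[leLHS]addr0 lerD// ler_nat; case: asboolP.
  by rewrite (asboolF rr0) add0r; apply: ler_indicator.
rewrite big_split /=; apply: lerD.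
  rewrite (le_trans (@sum_indicator_image _ _ _ [:: tt] (fun=> r0) _ (fun=> True) _ _))//.
  - exact: bx_uniq.
  - by move=> r _ ->; exists tt; rewrite ?mem_head.
  - by rewrite big_seq1 asboolT.
apply: (@le_trans _ _ (\sum_(y <- bx c n) `[< separated R M x0 y w >]%:R)).
  apply: (sum_indicator_image (f := rep M w)); first exact: bx_uniq.
  move=> r _ [[er tr [y by_ ry]] rr0]; exists y; first exact/mem_bx.
  have ey : rep M w y = r by rewrite -(rep_connected ry).
  split=> //; split=> //.
    by have [b bb rb] := tr; exists b => //; exact: connected_trans (connected_sym ry) rb.
  move=> /rep_connected e; apply: rr0.
  by rewrite -ey -e -(rep_connected r0x0).
apply: (@ler_term_sum R _ _ _ (fun x => \sum_(y <- bx c n) `[< separated R M x y w >]%:R)).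
  exact/mem_bx.
by move=> x; apply: sumr_ge0.
Qed.

(** Centres of boxes of radius [n] that cover the boundary of [Lambda(K)]: on a
    face one coordinate is fixed and the others run over multiples of [n]. *)
Definition multiples n K : seq int :=
  [seq k * n%:Z | k <- interval_list (- (K %/ n).+1%:Z) (2 * (K %/ n).+1).+1].
Arguments multiples : simpl never.

Definition face_centers n K (i : 'I_d) (b : bool) : seq (site d) :=
  grid (fun j => if j == i then [:: (((-1) ^+ b * K%:Z) %/ n%:Z)%Z * n%:Z]
                 else multiples n K).

Definition centers n K : seq (site d) :=
  flatten [seq face_centers n K ib.1 ib.2 | ib : 'I_d * bool].

Lemma size_centers n K :
  (size (centers n K) <= 2 * d * (2 * (K %/ n).+1).+1 ^ d.-1)%N.
Proof.
apply: size_flatten_faces => i b; apply: (@size_grid_face _ _ i) => [j ji|].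
  by rewrite (negbTE ji) size_map size_interval_list.
by rewrite eqxx.
Qed.

Lemma centers_cover n K x : (0 < n)%N -> inner_boundary R (box 0 K) x ->
  exists2 c, c \in centers n K & box c n x.
Proof.
move=> n0 /inner_boundaryP[/boxP bx0 [i hi]].
have [b hb] : exists b : bool, x ord0 i = (-1) ^+ b * K%:Z.
  by case: hi; rewrite mxE => ->; [exists false|exists true]; rewrite ?expr0 ?expr1; lia.
pose c : site d := \row_j ((x ord0 j %/ n%:Z)%Z * n%:Z).
have cE j : c ord0 j = (x ord0 j %/ n%:Z)%Z * n%:Z :> int by rewrite mxE.
have hdiv (a : int) : (a %/ n%:Z)%Z * n%:Z <= a < (a %/ n%:Z)%Z * n%:Z + n%:Z.
  have := divz_eq a n%:Z; have := @modz_ge0 a n%:Z; have := @ltz_pmod a n%:Z.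
  by lia.
exists c; last by apply/boxP => j; rewrite cE; have := hdiv (x ord0 j); lia.
apply/flatten_mapP; exists (i, b); first by rewrite mem_enum.
rewrite mem_grid; apply/forallP => j /=; case: eqP => [->|_].
  by rewrite inE cE hb.
rewrite cE; apply: (map_f (fun k => k * n%:Z)); rewrite mem_interval_list.
have := hdiv (x ord0 j); have := bx0 j; rewrite mxE.
have := ltn_ceil K n0; set q := (_ %/ _)%Z; set Q := (K %/ n)%N.
by move=> h1 h2 h3; nia.
Qed.

Lemma centers_box n K c i : (0 < n)%N -> c \in centers n K ->
  `|c ord0 i| <= (K + n)%:Z.
Proof.
move=> n0 /flatten_mapP[[k b] _]; rewrite mem_grid => /forallP/(_ i) /=.
have hQ := leq_trunc_div K n.
case: eqP => _; last first.
  move=> /mapP[q]; rewrite mem_interval_list => hq ->.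
  by move: hq hQ; set Q := (K %/ n)%N => hq hQ; nia.
rewrite inE => /eqP ->.
have := divz_eq ((-1) ^+ b * K%:Z) n%:Z; have := @modz_ge0 ((-1) ^+ b * K%:Z) n%:Z.
have := @ltz_pmod ((-1) ^+ b * K%:Z) n%:Z; set q := (_ %/ _)%Z.
by case: b q; rewrite ?expr0 ?expr1 => q; lia.
Qed.

Lemma crossing_number_cover n N w : (0 < n)%N -> (0 < N)%N ->
  crossing_number (4 * N) (box 0 (2 * N)) w <=
  \sum_(c <- centers n (2 * N)) crossing_number (4 * N) (box c n) w.
Proof.
move=> n0 N0; rewrite /crossing_number exchange_big /=; apply: ler_sum => r _.
apply: indicator_le_sum => -[er tr [x xA rx]].
have [b bb rb] := tr.
have nb_ : ~ box 0 (2 * N) b.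
  move=> /boxP h; have /inner_boundaryP[_ [i hi]] := bb.
  by have := h i; move: hi; rewrite mxE; lia.
have [a ba xa] := connected_boundary (connected_trans (connected_sym rx) rb) xA nb_.
have [c cC bca] := centers_cover n0 ba.
exists c => //; split => //; exists a => //.
apply: connected_trans rx _.
by apply: connected_mono xa => z [[]].
Qed.

Variable (p : R).
Hypotheses (p0 : 0 < p) (p1 : p < 1) (d0 : (0 < d)%N).
Hypothesis crit : forall n, 1 <= Phi d p n.

Let hp : 0 <= p <= 1. Proof. by rewrite !ltW. Qed.
Let hP : is_prob (fun _ : site d => p). Proof. exact: is_prob_const. Qed.

Definition separated_bound n N : R :=
  (1 + (link_bound d p n)^-1) * ((((4 * n).+1 ^ d)%N)%:R * (alpha d p N / (1 - p))).

Lemma Ex_crossing_number n N w : (0 < n)%N -> (3 * n < N)%N ->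
  Ex (fun=> p) (bx 0 (4 * N)) (crossing_number (4 * N) (box 0 (2 * N))) w <=
  (2 * d * (2 * (2 * N %/ n).+1).+1 ^ d.-1)%:R *
  (1 + ((2 * n).+1 ^ (2 * d))%:R * separated_bound n N).
Proof.
move=> n0 nN; have N0 : (0 < N)%N by lia.
set B := 1 + _.
have sb0 : 0 <= separated_bound n N.
  rewrite mulr_ge0 ?addr_ge0 ?invr_ge0 ?(ltW (link_bound_gt0 _ _ _))//.
  rewrite mulr_ge0 ?ler0n// divr_ge0 ?subr_ge0//.
    exact: Pr_ge0.
  exact: ltW.
have B0 : 0 <= B by rewrite addr_ge0// mulr_ge0.
apply: (@le_trans _ _ (\sum_(c <- centers n (2 * N)) B)); last first.
  rewrite big_const_seq count_predT iter_addr_0 -[leLHS]mulr_natl ler_wpM2r//.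
  by rewrite ler_nat size_centers.
apply: le_trans (le_Ex _ _ hP (fun w => crossing_number_cover w n0 N0)) _.
rewrite Ex_sum big_seq [leRHS]big_seq; apply: ler_sum => c cC.
apply: le_trans (le_Ex _ _ hP (@crossing_number_local _ c n)) _.
rewrite ExD Ex_const lerD2l Ex_sum.
apply: (@le_trans _ _ (\sum_(x <- bx c n) \sum_(y <- bx c n) separated_bound n N)).
  rewrite big_seq [leRHS]big_seq; apply: ler_sum => x /mem_bx bx_.
  rewrite Ex_sum big_seq [leRHS]big_seq; apply: ler_sum => y /mem_bx by_.
  have cM i : `|c ord0 i| + (2 * n)%:Z + N%:Z < (4 * N)%:Z.
    by move: (centers_box i n0 cC) nN; set a := `|c ord0 i|; lia.
  have := Pr_separated p0 p1 d0 crit N0 cM bx_ by_.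
  rewrite size_bx mulnA -[(2 * 2)%N]/4%N; apply: le_trans.
  rewrite le_eqVlt; apply/orP; left; apply/eqP.
  apply: (@Ex_eq_outside _ _ (box 0 (4 * N))).
    by move=> w1 w2 ww; apply: indicator_congr; split; apply: separated_congr => z /ww.
  by move=> z /negP nz /mem_bx.
rewrite !big_const_seq !count_predT !iter_addr_0 -mulrnA -[leLHS]mulr_natl.
by rewrite size_bx -expnD addnn -mul2n.
Qed.

End Counting.

(** * The Aizenman-Kesten-Newman inequality *)

Section AKN.
Variables (R : realType) (d : nat).
Implicit Types (x y z c a b r : site d) (w : configuration d).

Local Notation nb := (@neighbor R d).
Local Notation conn := (@connected_in R d).

(** Linear terms of a likelihood ratio are controlled up to second order. *)
Lemma expR_sub_sqr_le (u : R) : `|u| <= 1 / 2 -> expR (u - 2 * u ^+ 2) <= 1 + u.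
Proof.
rewrite ler_norml => /andP[u1 u2].
have h : 1 - u + 2 * u ^+ 2 <= expR (- (u - 2 * u ^+ 2)).
  by apply: le_trans (expR_ge1Dx _); lra.
have e0 := expR_gt0 (u - 2 * u ^+ 2).
have h1 : expR (u - 2 * u ^+ 2) * (1 - u + 2 * u ^+ 2) <= 1.
  by have := ler_wpM2l (ltW e0) h; rewrite expRxMexpNx_1.
have a0 : 0 < 1 - u + 2 * u ^+ 2 by nra.
rewrite -(ler_pM2r a0); apply: le_trans h1 _.
have := sqr_ge0 u; have : 0 <= 1 + 2 * u by lra.
by set v := u ^+ 2 => h2 h3; rewrite /v in h3 *; nra.
Qed.

Lemma expR_sum_le (I : Type) (s : seq I) (Q : pred I) (u : I -> R) :
  (forall i, `|u i| <= 1 / 2) ->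
  expR (\sum_(i <- s | Q i) (u i - 2 * u i ^+ 2)) <= \prod_(i <- s | Q i) (1 + u i).
Proof.
move=> hu; elim: s => [|i s IH]; first by rewrite !big_nil expR0.
rewrite !big_cons; case: (Q i) => //; rewrite expRD ler_pM ?expR_ge0//.
exact: expR_sub_sqr_le.
Qed.

(** The tangent inequality for the exponential at [ln m]. *)
Lemma le_ln_expR_div (t m : R) : 0 < m -> t <= ln m + expR t / m.
Proof.
move=> m0; have := expR_ge1Dx (t - ln m).
by rewrite expRD expRN lnK ?posrE//; lra.
Qed.

Variable (N : nat).
Hypothesis N0 : (0 < N)%N.
Local Notation M := (4 * N)%N.
Local Notation cross w r := (crossing_rep R M (box 0 (2 * N)) w r).

(** In how many explorations of crossing clusters the site [y] is seen. *)
Definition multiplicity y w : R :=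
  \sum_(r <- bx 0 M) `[< cross w r /\ explored R (box 0 M) w r y >]%:R.

(** Whether [y] belongs or is adjacent to a cluster touching the boundary; this
    is phrased so as not to look at the state of [y]. *)
Definition near_touching y w :=
  exists2 z, nb z y & exists2 b : site d, inner_boundary R (box 0 M) b &
    conn w (box 0 M `&` [set t | t != y]) z b.

Definition separating y w :=
  w y = false /\ exists y' z', [/\ nb y y', nb y z' & separated R M y' z' w].

Lemma touches_open w r : touches R M w r -> open_in w (box 0 M) r.
Proof. by move=> [b _ /connected_openl]. Qed.

Lemma explored_rep w r y : cross w r -> explored R (box 0 M) w r y ->
  exists2 z, z \in y :: nbrs y & rep R M w z = r /\ conn w (box 0 M) r z.
Proof.
move=> [er tr _] /asboolP[_ [yr|[z rz zy]]].
  exists y; rewrite ?mem_head// yr; split => //.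
  exact/connected_refl/touches_open.
exists z; first by rewrite inE (mem_nbrs R) neighbor_sym zy orbT.
by split => //; rewrite -(rep_connected rz).
Qed.

Lemma multiplicity_le y w : multiplicity y w <= (2 * d).+1%:R.
Proof.
apply: (@le_trans _ _ (\sum_(z <- y :: nbrs y) `[< True >]%:R)).
  apply: (@sum_indicator_image R _ _ _ _ (rep R M w)); first exact: bx_uniq.
  by move=> r _ [cr /(explored_rep cr)[z zy [ez _]]]; exists z.
by rewrite asboolT// big_const_seq count_predT iter_addr_0 /= size_nbrs.
Qed.

Lemma boundary_far y b : box 0 N y -> inner_boundary R (box 0 M) b -> b != y.
Proof.
move=> /boxP hy /inner_boundaryP[_ [i hi]]; apply/eqP => e; have := hy i.
by move: hi; rewrite e mxE; lia.
Qed.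

(** An open site is seen only by the exploration of its own cluster. *)
Lemma multiplicity_open y w : box 0 N y -> w y ->
  multiplicity y w <= `[< near_touching y w >]%:R.
Proof.
move=> hy wy; rewrite -[leRHS](big_seq1 +%R tt (fun=> `[< near_touching y w >]%:R)).
apply: (@sum_indicator_image R _ _ _ _ (fun=> rep R M w y)); first exact: bx_uniq.
move=> r _ [[er tr [x xA rx]] ex]; exists tt; first exact: mem_head.
have ry := explored_open (touches_open tr) ex wy.
split; last by rewrite -(rep_connected ry).
have [b bb rb] := tr.
have yb : conn w (box 0 M) b y := connected_trans (connected_sym rb) ry.
have [z [y' [bz zy' _ /negP]]] := connected_exit yb
  (boundary_far hy bb : [set t | t != y] b) (fun h => negP h (eqxx y)).
rewrite negbK => /eqP yy'.
by exists z; [rewrite -yy'|exists b => //; exact: connected_sym].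
Qed.

Lemma rep_crossing w z : box 0 (2 * N) z -> touches R M w z ->
  rep R M w z \in bx 0 M /\ cross w (rep R M w z).
Proof.
move=> zA tz; have zr := connected_rep R (touches_open tz).
split; first by apply/mem_bx; case: (connected_openr zr).
split; first exact: (rep_id R (touches_open tz)).
  by have [b bb zb] := tz; exists b => //; exact: connected_trans (connected_sym zr) zb.
by exists z => //; exact: connected_sym.
Qed.

Lemma neighbor_box2 y z : box 0 N y -> nb z y -> box 0 (2 * N) z.
Proof.
move=> /boxP hy zy; apply/boxP => i; have := hy i; have := neighbor_dist i zy.
by rewrite mxE; lia.
Qed.

Lemma explored_neighbor w y z : box 0 N y -> nb z y -> touches R M w z ->
  explored R (box 0 M) w (rep R M w z) y.
Proof.
move=> hy zy tz; apply/asboolP; split.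
  by move: y hy {zy}; apply: box_sub => i; rewrite subrr normr0; lia.
by right; exists z => //; exact: (connected_sym (connected_rep R (touches_open tz))).
Qed.

(** A closed site is seen by each of the clusters that it separates. *)
Lemma multiplicity_closed y w : box 0 N y -> w y = false ->
  `[< near_touching y w >]%:R + `[< separating y w >]%:R <= multiplicity y w.
Proof.
move=> hy wy; have [sy|nsy] := pselect (separating y w).
  have [_ [y' [z' [yy' yz' [ty' tz' ns]]]]] := sy.
  have y'y : nb y' y by rewrite neighbor_sym.
  have z'y : nb z' y by rewrite neighbor_sym.
  have [in1 cr1] := rep_crossing (neighbor_box2 hy y'y) ty'.
  have [in2 cr2] := rep_crossing (neighbor_box2 hy z'y) tz'.
  have rr : rep R M w y' != rep R M w z'.
    apply/eqP => e; apply: ns; have := connected_rep R (touches_open ty').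
    rewrite e => h; apply: connected_trans h _.
    exact: (connected_sym (connected_rep R (touches_open tz'))).
  apply: (@le_trans _ _ (\sum_(r <- [:: rep R M w y'; rep R M w z']) `[< True >]%:R)).
    by rewrite !big_cons big_nil (asboolT I) addr0 lerD// ler_nat; case: asboolP.
  apply: (@sum_indicator_image R _ _ _ _ (id)); first by rewrite /= inE rr.
  move=> r; rewrite !inE => /orP[] /eqP -> _.
    by exists (rep R M w y') => //; split => //; split => //; exact: explored_neighbor.
  by exists (rep R M w z') => //; split => //; split => //; exact: explored_neighbor.
rewrite (asboolF nsy) addr0; case: asboolP => [[z zy [b bb zb]]|_]; last exact: sumr_ge0.
have tz : touches R M w z by exists b => //; apply: connected_mono zb => t [[]].
have [in1 cr1] := rep_crossing (neighbor_box2 hy zy) tz.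
rewrite -[leLHS](_ : `[< cross w (rep R M w z) /\
    explored R (box 0 M) w (rep R M w z) y >]%:R = _); last first.
  by rewrite asboolT//; split => //; exact: explored_neighbor.
exact: (@ler_term_sum R _ _ _ (fun r => `[< cross w r /\ explored R (box 0 M) w r y >]%:R)).
Qed.

Lemma two_arms_separating y w : box 0 N y -> two_arms R y (8 * N) w -> separating y w.
Proof.
move=> hy h; split; first exact: two_arms_closed h.
move: h => /two_armsP[y' [z' [a [b [[yy' yz'] nyz [ya ba] [zb bb]]]]]].
have sub : box 0 M `<=` box y (8 * N).
  by apply: box_sub => i; move/boxP: hy => /(_ i); rewrite mxE; lia.
have sub2 : box (0 : site d) (2 * N) `<=` box 0 M.
  by apply: box_sub => i; rewrite subrr normr0; lia.
have far e : inner_boundary R (box y (8 * N)) e -> ~ box 0 M e.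
  move=> /inner_boundaryP[_ [i hi]] /boxP/(_ i).
  by move/boxP: hy => /(_ i); move: hi; rewrite mxE; lia.
have touch u e : nb y u -> conn w (box y (8 * N)) u e ->
    inner_boundary R (box y (8 * N)) e -> touches R M w u.
  move=> yu ue be; have hu : box 0 M u.
    by apply/sub2/(neighbor_box2 hy); rewrite neighbor_sym.
  have [f bf uf] := connected_boundary ue hu (far _ be).
  by exists f => //; apply: connected_mono uf => t [[]].
exists y', z'; split => //; split; [exact: touch ba|exact: touch bb|].
by move=> yz; apply: nyz; apply: connected_mono yz => t [/sub].
Qed.

Lemma separating_depends y : box 0 N y ->
  depends_on (box 0 M) (fun w => `[< separating y w >]).
Proof.
move=> hy; have yM : box 0 M y.
  by move: y hy; apply: box_sub => i; rewrite subrr normr0; lia.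
have h w w' : (forall z, box 0 M z -> w z = w' z) -> separating y w -> separating y w'.
  move=> ww' [wy [y' [z' [yy' yz' s]]]]; split; first by rewrite -ww'.
  by exists y', z'; split => //; exact: separated_congr s.
by move=> w w' ww'; apply/asboolP/asboolP; apply: h => // z /ww' ->.
Qed.

Variable (p : R).
Hypotheses (p0 : 0 < p) (p1 : p < 1).

Let hp : 0 <= p <= 1. Proof. by rewrite !ltW. Qed.
Let hP : is_prob (fun _ : site d => p). Proof. exact: is_prob_const. Qed.

(** The logarithmic derivative, with the opposite sign, of the Bernoulli weight
    at the density [p]. *)
Definition score (b : bool) : R := (p - b%:R) / (p * (1 - p)).

Lemma pq_gt0 : 0 < p * (1 - p).
Proof. by rewrite mulr_gt0// subr_gt0. Qed.

Lemma score_bound (b : bool) : `|score b| <= (p * (1 - p))^-1.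
Proof.
rewrite normrM normfV (gtr0_norm pq_gt0) ler_piMl ?invr_ge0 ?(ltW pq_gt0)//.
by case: b; rewrite ?mulr1n ?mulr0n; rewrite ler_norml; move: p0 p1; lra.
Qed.

(** Tilting the density inside [Lambda(N)] from [p] to [p - delta]. *)
Definition tilt (delta : R) y (b : bool) : R :=
  1 + (if y \in bx 0 N then delta * score b else 0).

Lemma tilt_mean delta y : p * tilt delta y true + (1 - p) * tilt delta y false = 1.
Proof.
have pq0 : p * (1 - p) != 0 by rewrite gt_eqF// pq_gt0.
have p0' : p != 0 by rewrite gt_eqF.
have q0' : 1 - p != 0 by rewrite gt_eqF// subr_gt0.
rewrite /tilt /score; case: ifP => _; last by ring.
by rewrite mulr1n mulr0n; field; rewrite p0' q0'.
Qed.

Definition likelihood delta r w : R :=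
  \prod_(y <- bx 0 M | explored R (box 0 M) w r y) tilt delta y (w y).

Lemma Ex_likelihood delta r w0 : Ex (fun=> p) (bx 0 M) (likelihood delta r) w0 = 1.
Proof.
apply: (@Ex_stopping_prod R _ (fun w => explored R (box 0 M) w r)).
- exact: bx_uniq.
- exact: explored_stopping.
- by move=> w y /asboolP[/mem_bx].
- by move=> y; exact: tilt_mean.
Qed.

Lemma sub_boxNM : {subset bx (0 : site d) N <= bx 0 M}.
Proof. by apply: sub_bx; apply: box_sub => i; rewrite subrr normr0; lia. Qed.

(** The total score of a cluster is at most logarithmic, up to a second order
    term and a multiple of a likelihood ratio. Dividing by the volume makes the
    sum of these multiples over all sites of mean one. *)
Lemma likelihood_lower delta r w : 0 < delta -> delta <= p * (1 - p) / 2 ->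
  \sum_(y <- bx 0 N) (delta * score (w y) - 2 * (delta / (p * (1 - p))) ^+ 2) *
    `[< explored R (box 0 M) w r y >]%:R <=
  ln (size (bx (0 : site d) M))%:R + likelihood delta r w / (size (bx (0 : site d) M))%:R.
Proof.
move=> delta0 hdelta; set m : R := (size _)%:R.
have m0 : 0 < m by rewrite ltr0n size_bx expn_gt0.
pose u y := if y \in bx 0 N then delta * score (w y) else 0.
have us y : `|delta * score (w y)| <= delta / (p * (1 - p)).
  by rewrite normrM gtr0_norm// ler_wpM2l ?(ltW delta0)//; exact: score_bound.
have d2 : delta / (p * (1 - p)) <= 1 / 2.
  by rewrite ler_pdivrMr ?pq_gt0// mulrC mulrA mulr1.
have hu y : `|u y| <= 1 / 2.
  rewrite /u; case: ifP => _; first exact: le_trans (us y) d2.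
  by rewrite normr0 divr_ge0.
have h := expR_sum_le (bx 0 M) (explored R (box 0 M) w r) hu.
apply: le_trans (le_trans _ (le_ln_expR_div
   (\sum_(y <- bx 0 M | explored R (box 0 M) w r y) (u y - 2 * u y ^+ 2)) m0)) _; last first.
  by rewrite lerD2l ler_wpM2r ?invr_ge0 ?(ltW m0).
rewrite [leRHS](perm_big ([seq y <- bx 0 M | y \notin bx 0 N] ++ bx 0 N)) /=; last first.
  by apply: perm_cat_filter_notin; [exact: bx_uniq|exact: bx_uniq|exact: sub_boxNM].
rewrite big_cat /= [X in _ <= X + _]big_seq_cond [X in _ <= X + _]big1 ?add0r => [|y]; last first.
  rewrite mem_filter => /andP[/andP[/negbTE yN _] _].
  by rewrite /u yN expr0n /= mulr0 subr0.
rewrite [leRHS]big_mkcond big_seq [leRHS]big_seq; apply: ler_sum => y yN.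
rewrite asboolb; case: (explored _ _ _ _ _); last by rewrite mulr0.
rewrite mulr1 /u yN lerB// ler_wpM2l//.
by rewrite -real_normK ?num_real// lerXn2r ?nnegrE// (le_trans _ (us y)).
Qed.

(** Sum the bounds on the likelihoods over the crossing clusters. On the left
    the scores of a closed site adjacent to two of them are counted twice,
    while counting each site once would give a centered variable. *)
Lemma AKN_pointwise delta w : 0 < delta -> delta <= p * (1 - p) / 2 ->
  delta / (p * (1 - p)) *
    \sum_(y <- bx 0 N) ((p - (w y)%:R) * `[< near_touching y w >]%:R +
                        p * `[< separating y w >]%:R) <=
  crossing_number R M (box 0 (2 * N)) w * ln (size (bx (0 : site d) M))%:R +
  (\sum_(r <- bx 0 M) likelihood delta r w) / (size (bx (0 : site d) M))%:R +
  2 * (delta / (p * (1 - p))) ^+ 2 * (2 * d).+1%:R * (size (bx (0 : site d) N))%:R.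
Proof.
move=> delta0 hdelta; set m : R := (size (bx _ M))%:R; set e := delta / _.
have m0 : 0 < m by rewrite ltr0n size_bx expn_gt0.
have pq := pq_gt0; have e0 : 0 < e by rewrite divr_gt0.
have L0 r : 0 <= likelihood delta r w.
  apply: prodr_ge0 => y _; rewrite /tilt; case: ifP => _; last by rewrite addr0.
  have : `|delta * score (w y)| <= 1.
    rewrite normrM gtr0_norm//; apply: le_trans (ler_wpM2l (ltW delta0) (score_bound _)) _.
    by rewrite ler_pdivrMr// mul1r (le_trans hdelta)// ler_pdivrMr// ler_peMr ?ltW// ltr1n.
  by rewrite ler_norml; lra.
apply: (@le_trans _ _ (\sum_(y <- bx 0 N) ((delta * score (w y) - 2 * e ^+ 2) * multiplicity y w
    + 2 * e ^+ 2 * (2 * d).+1%:R))).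
  rewrite mulr_sumr big_seq [leRHS]big_seq; apply: ler_sum => y /mem_bx hy.
  have mle := multiplicity_le y w.
  have m_ge0 : 0 <= multiplicity y w by exact: sumr_ge0.
  apply: (@le_trans _ _ (e * ((p - (w y)%:R) * multiplicity y w))).
    rewrite ler_wpM2l ?(ltW e0)//; case wy : (w y).
      have := multiplicity_open hy wy.
      rewrite [X in p * X](_ : _ = 0); last by rewrite asboolF// => -[]; rewrite wy.
      by rewrite mulr0 addr0 => h; rewrite ler_wnM2l// subr_le0 ltW.
    have := multiplicity_closed hy wy; rewrite subr0 -mulrDr => h.
    by rewrite ler_wpM2l// ltW.
  have -> : delta * score (w y) = e * (p - (w y)%:R) by rewrite /score /e mulrA [RHS]mulrAC.
  have e2 : 0 <= 2 * e ^+ 2 by rewrite mulr_ge0// sqr_ge0.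
  have := ler_wpM2l e2 mle; rewrite mulrBl mulrA; lra.
rewrite big_split /= [X in _ + X <= _](_ : _ =
    2 * e ^+ 2 * (2 * d).+1%:R * (size (bx (0 : site d) N))%:R); last first.
  by rewrite big_const_seq count_predT iter_addr_0 -[LHS]mulr_natr.
rewrite lerD2r.
apply: (@le_trans _ _ (\sum_(r <- bx 0 M)
    (`[< cross w r >]%:R * ln m + likelihood delta r w / m))); last first.
  by rewrite big_split /= -!mulr_suml.
rewrite (eq_bigr (fun y => \sum_(r <- bx 0 M) (delta * score (w y) - 2 * e ^+ 2) *
    `[< cross w r /\ explored R (box 0 M) w r y >]%:R)); last first.
  by move=> y _; rewrite mulr_sumr.
(* the sum over sites of scores times multiplicities is a sum over clusters *)
rewrite exchange_big /=; apply: ler_sum => r _.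
have [cr|ncr] := pselect (cross w r); last first.
  rewrite (asboolF ncr) mul0r add0r big1 ?divr_ge0 ?(ltW m0)// => y _.
  by rewrite asboolF ?mulr0// => -[].
rewrite (asboolT cr) mul1r; apply: le_trans (likelihood_lower r w delta0 hdelta).
rewrite le_eqVlt; apply/orP; left; apply/eqP; apply: eq_bigr => y _.
by congr (_ * _); apply: indicator_congr; split => [[]|h].
Qed.

Lemma near_touching_depends y :
  depends_on (fun x => x != y) (fun w => `[< near_touching y w >]%:R : R).
Proof.
suff h w w' : (forall x, x != y -> w x = w' x) -> near_touching y w -> near_touching y w'.
  by move=> w w' ww'; apply: indicator_congr; split; apply: h => // x /ww' ->.
move=> ww' [z zy [b bb zb]]; exists z => //; exists b => //.
by apply: connected_in_congr zb => t [_ /ww'].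
Qed.

(** In the pointwise inequality the terms with [near_touching] are centered, and
    the likelihood ratios have mean one. *)
Lemma AKN delta w0 : 0 < delta -> delta <= p * (1 - p) / 2 ->
  delta / (1 - p) * ((size (bx (0 : site d) N))%:R * alpha d p (8 * N)) <=
  Ex (fun=> p) (bx 0 M) (crossing_number R M (box 0 (2 * N))) w0 *
    ln (size (bx (0 : site d) M))%:R + 1 +
  2 * (delta / (p * (1 - p))) ^+ 2 * (2 * d).+1%:R * (size (bx (0 : site d) N))%:R.
Proof.
move=> delta0 hdelta.
have m0 : 0 < (size (bx (0 : site d) M))%:R :> R by rewrite ltr0n size_bx expn_gt0.
have := le_Ex (bx 0 M) w0 hP (fun w => AKN_pointwise w delta0 hdelta).
rewrite !ExZ !ExD.
have -> : Ex (fun=> p) (bx 0 M) (fun w => crossing_number R M (box 0 (2 * N)) w *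
    ln (size (bx (0 : site d) M))%:R) w0 =
  Ex (fun=> p) (bx 0 M) (crossing_number R M (box 0 (2 * N))) w0 *
    ln (size (bx (0 : site d) M))%:R.
  by rewrite mulrC -ExZ; apply: eq_Ex => w; rewrite mulrC.
have -> : Ex (fun=> p) (bx 0 M) (fun w => (\sum_(r <- bx 0 M) likelihood delta r w) /
    (size (bx (0 : site d) M))%:R) w0 = 1.
  under eq_Ex do rewrite mulrC.
  rewrite ExZ Ex_sum; under eq_bigr do rewrite Ex_likelihood.
  by rewrite big_const_seq count_predT iter_addr_0 mulVf// gt_eqF.
rewrite Ex_const; apply: le_trans.
rewrite Ex_sum.
have -> : delta / (1 - p) * ((size (bx (0 : site d) N))%:R * alpha d p (8 * N)) =
    delta / (p * (1 - p)) * \sum_(y <- bx (0 : site d) N) (p * alpha d p (8 * N)).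
  rewrite big_const_seq count_predT iter_addr_0 -[X in _ = _ * X]mulr_natl.
  have p0' : p != 0 by rewrite gt_eqF.
  have q0' : 1 - p != 0 by rewrite gt_eqF// subr_gt0.
  by field; rewrite p0' q0'.
rewrite ler_wpM2l//; first by rewrite divr_ge0 ?(ltW delta0) ?(ltW pq_gt0).
rewrite big_seq [leRHS]big_seq; apply: ler_sum => y yN.
rewrite ExD (Ex_centered _ _ (bx_uniq _ _) (sub_boxNM yN) (@near_touching_depends y)) add0r.
rewrite ExZ ler_wpM2l ?(ltW p0)//; move: yN => /mem_bx yN.
(* a box that contains both the range of the two arms and [Lambda(4 N)] *)
have sub : box y (8 * N) `<=` box 0 (9 * N).
  by apply: box_sub => i; move/boxP: yN => /(_ i); rewrite mxE; lia.
have sub' : box (0 : site d) M `<=` box 0 (9 * N).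
  by apply: box_sub => i; rewrite subrr normr0; lia.
rewrite /alpha -(Pr_two_arms_translate p y).
rewrite -(@Pr_marginal R d p (bx y (8 * N)) (bx 0 (9 * N)) _ (fun=> false)); last 4 first.
- exact: bx_uniq.
- exact: bx_uniq.
- exact: sub_bx.
- exact/depends_on_bx/two_arms_depends.
have dep := depends_on_bx (separating_depends yN).
rewrite (Pr_marginal p w0 (bx_uniq _ _) (bx_uniq _ _) _ dep)//.
rewrite -(Pr_marginal p (fun=> false) (bx_uniq _ _) (bx_uniq _ _) (sub_bx sub') dep).
by apply: le_Pr => // w; exact: two_arms_separating.
Qed.

End AKN.

(** * A recursive inequality for the two-arms probability *)

Section Recursion.
Variables (R : realType) (d : nat) (p : R).
Hypotheses (p0 : 0 < p) (p1 : p < 1) (d0 : (0 < d)%N).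
Hypothesis crit : forall n, 1 <= Phi d p n.
Implicit Types (n m N : nat).

Let hp : 0 <= p <= 1. Proof. by rewrite !ltW. Qed.
Let hP : is_prob (fun _ : site d => p). Proof. exact: is_prob_const. Qed.

Local Notation alpha := (alpha d p).

Lemma alpha_ge0 n : 0 <= alpha n.
Proof. exact: Pr_ge0. Qed.

Lemma alpha_le1 n : alpha n <= 1.
Proof. exact: Pr_le1. Qed.

Lemma alpha_anti n m : (0 < n <= m)%N -> alpha m <= alpha n.
Proof.
move=> /andP[n0 nm].
have sub : box (0 : site d) n `<=` box 0 m.
  by apply: box_sub => i; rewrite subrr normr0; lia.
rewrite /alpha -(@Pr_marginal R d p (bx 0 n) (bx 0 m) _ (fun=> false)); last 4 first.
- exact: bx_uniq.
- exact: bx_uniq.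
- exact: sub_bx.
- exact/depends_on_bx/two_arms_depends.
by apply: le_Pr => // w; apply: two_arms_anti; rewrite n0.
Qed.

Lemma ler_natS_mul (a b n : nat) : (0 < n)%N -> (b <= a)%N ->
  ((b * n).+1)%:R <= (a.+1)%:R * n%:R :> R.
Proof. by move=> n0 ba; rewrite -natrM ler_nat; nia. Qed.

Lemma exponent_split k : (0 < k)%N -> (2 * k ^ 2 + k = 2 * k + 2 * k * k.-1 + k)%N.
Proof.
by case: k => // k _; rewrite -mulnn /= -addn1; ring.
Qed.

Lemma center_count_le n N : (3 * n < N)%N ->
  ((2 * (2 * N %/ n).+1).+1 * n <= 7 * N)%N.
Proof.
move=> nN; have := leq_trunc_div (2 * N) n; set Q := (_ %/ _)%N => hQ.
by lia.
Qed.

Lemma link_bound_inv : exists2 A : R, 0 < A & forall n, (0 < n)%N ->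
  1 + (link_bound d p n)^-1 <= A * n%:R ^+ (2 * d * d.-1).
Proof.
pose a : R := 8 * d%:R ^+ 2 * 3 ^+ d.-1.
have a0 : 0 < a by rewrite !mulr_gt0 ?exprn_gt0 ?ltr0n.
pose A1 : R := p^-1 * ((p ^+ 3)^-1 * a ^+ 2) ^+ d.
have A10 : 0 < A1.
  apply: mulr_gt0; first by rewrite invr_gt0.
  by apply/exprn_gt0/mulr_gt0; rewrite ?invr_gt0 exprn_gt0.
exists (1 + A1); first by rewrite addr_gt0.
move=> n n0; have n1 : 1 <= n%:R :> R by rewrite ler1n.
have f : (face_bound R d n)^-1 <= a * n%:R ^+ d.-1.
  rewrite /face_bound invrK /a -[leRHS]mulrA ler_wpM2l ?mulr_ge0 ?exprn_ge0//.
  rewrite -exprMn lerXn2r ?nnegrE ?mulr_ge0//.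
  exact: (@ler_natS_mul 2 2).
have f0 : 0 <= (face_bound R d n)^-1 by rewrite invr_ge0 ltW// face_bound_gt0.
have -> : (2 * d * d.-1 = d.-1 * 2 * d)%N by rewrite mulnC mulnA.
rewrite mulrDl mul1r lerD ?exprn_ege1//.
have -> : (link_bound d p n)^-1 =
    p^-1 * ((p ^+ 3)^-1 * (face_bound R d n)^-1 ^+ 2) ^+ d.
  by rewrite /link_bound /line_bound invfM -exprVn invfM -(exprVn _ 2).
rewrite /A1 -[leRHS]mulrA ler_wpM2l ?invr_ge0 ?(ltW p0)//.
have p30 : 0 <= (p ^+ 3)^-1 by rewrite invr_ge0 exprn_ge0// ltW.
rewrite exprM -exprMn lerXn2r ?nnegrE ?mulr_ge0 ?exprn_ge0 ?(ltW a0)//.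
rewrite -mulrA ler_wpM2l// exprM -exprMn.
by rewrite lerXn2r ?nnegrE ?mulr_ge0 ?exprn_ge0 ?(ltW a0).
Qed.

(** The power of [n] adds up the pairs of sites of a small box ([2 d]), the
    sites that may be pivotal ([d]) and the connection inside a box
    ([2 d (d - 1)]). *)
Lemma Ex_crossing_poly : exists2 A : R, 0 < A &
  forall N n (w : configuration d), (0 < n)%N -> (3 * n < N)%N ->
  Ex (fun=> p) (bx 0 (4 * N)) (crossing_number R (4 * N) (box (0 : site d) (2 * N))) w <=
  A * (N%:R / n%:R) ^+ d.-1 * (1 + n%:R ^+ (2 * d ^ 2 + d) * alpha N).
Proof.
have [A A0 hA] := link_bound_inv.
have q0 : 0 < 1 - p by rewrite subr_gt0.
pose B : R := 3 ^+ (2 * d) * (A * (5 ^+ d * (1 - p)^-1)).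
have B0 : 0 < B by rewrite !mulr_gt0 ?exprn_gt0 ?invr_gt0.
pose K : R := (2 * d)%:R * 7 ^+ d.-1.
have K0 : 0 < K by rewrite mulr_gt0 ?exprn_gt0// ltr0n muln_gt0.
exists (K * (1 + B)); first by rewrite mulr_gt0// addr_gt0.
move=> N n w n0 nN.
apply: le_trans (Ex_crossing_number p0 p1 d0 crit w n0 nN) _.
have nR : 0 < n%:R :> R by rewrite ltr0n.
have h1 : (2 * d * (2 * (2 * N %/ n).+1).+1 ^ d.-1)%:R <= K * (N%:R / n%:R) ^+ d.-1.
  rewrite /K -mulrA -exprMn natrM natrX ler_wpM2l ?ler0n//.
  rewrite lerXn2r ?nnegrE ?mulr_ge0 ?divr_ge0 ?ler0n//.
  rewrite mulrA ler_pdivlMr// -!natrM ler_nat.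
  exact: center_count_le.
have h2 : 1 + ((2 * n).+1 ^ (2 * d))%:R * separated_bound d p n N <=
    (1 + B) * (1 + n%:R ^+ (2 * d ^ 2 + d) * alpha N).
  have aN := alpha_ge0 N.
  have e0 : 0 <= n%:R ^+ (2 * d ^ 2 + d) * alpha N by rewrite mulr_ge0// exprn_ge0.
  suff : ((2 * n).+1 ^ (2 * d))%:R * separated_bound d p n N <=
      B * (n%:R ^+ (2 * d ^ 2 + d) * alpha N).
    by move: e0 B0; set X := n%:R ^+ _ * _; set Y := _ * separated_bound d p n N; nra.
  have -> : B * (n%:R ^+ (2 * d ^ 2 + d) * alpha N) =
      (3 * n%:R) ^+ (2 * d) *
      (A * n%:R ^+ (2 * d * d.-1) * ((5 * n%:R) ^+ d * (alpha N / (1 - p)))).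
    rewrite (exponent_split d0).
    by rewrite /B !exprD !exprMn; ring.
  rewrite /separated_bound natrX; apply: ler_pM => //.
  - rewrite mulr_ge0 ?addr_ge0 ?invr_ge0 ?(ltW (link_bound_gt0 p0 d0 n))//.
    by rewrite mulr_ge0// divr_ge0// ltW.
  - by rewrite lerXn2r ?nnegrE ?mulr_ge0//; exact: (@ler_natS_mul 2 2).
  apply: ler_pM; [by rewrite addr_ge0 ?invr_ge0 ?(ltW (link_bound_gt0 p0 d0 n))| |exact: hA|].
    by rewrite mulr_ge0// divr_ge0// ltW.
  rewrite ler_wpM2r ?divr_ge0 ?(ltW q0)// natrX lerXn2r ?nnegrE ?mulr_ge0//.
  exact: (@ler_natS_mul 4 4).
rewrite [leRHS](_ : _ = (K * (N%:R / n%:R) ^+ d.-1) *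
    ((1 + B) * (1 + n%:R ^+ (2 * d ^ 2 + d) * alpha N))).
  apply: ler_pM => //; rewrite addr_ge0// mulr_ge0// /separated_bound.
  rewrite mulr_ge0 ?addr_ge0 ?invr_ge0 ?(ltW (link_bound_gt0 p0 d0 n))//.
  by rewrite mulr_ge0// divr_ge0 ?alpha_ge0// ltW.
by ring.
Qed.

(** The exponent 1/2 comes from balancing the two terms with [n = 1]; a larger
    [n] reduces the number of clusters that have to be taken into account. *)
Lemma alpha_recursion : exists2 A : R, 0 < A & forall N n (delta : R),
  (0 < n)%N -> (3 * n < N)%N -> 0 < delta -> delta <= p * (1 - p) / 2 ->
  alpha (8 * N) <= A * (delta^-1 * (N%:R * n%:R ^+ d.-1)^-1 *
    (1 + n%:R ^+ (2 * d ^ 2 + d) * alpha N) * (1 + ln N%:R) + delta).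
Proof.
have [A A0 hA] := Ex_crossing_poly.
have q0 : 0 < 1 - p by rewrite subr_gt0.
pose B : R := d%:R * (1 + ln 9).
have ln9 : 0 <= ln 9 :> R by rewrite ln_ge0// ler1n.
have B0 : 0 < B by rewrite mulr_gt0 ?ltr0n// ltr_wpDr.
pose C : R := 2 * ((p * (1 - p))^-1) ^+ 2 * (2 * d).+1%:R.
have C0 : 0 < C by rewrite !mulr_gt0 ?exprn_gt0 ?invr_gt0 ?mulr_gt0 ?ltr0n.
exists ((1 - p) * (A * B + 1 + C)); first by rewrite mulr_gt0// !addr_gt0// mulr_gt0.
move=> N n delta n0 nN delta0 hdelta.
have N0 : (0 < N)%N by exact: leq_ltn_trans nN.
have NR : 0 < N%:R :> R by rewrite ltr0n.
have N1 : 1 <= N%:R :> R by rewrite ler1n.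
have nR : 0 < n%:R :> R by rewrite ltr0n.
have lnN : 0 <= ln N%:R :> R by rewrite ln_ge0.
have := AKN N0 p0 p1 (fun _ : site d => false) delta0 hdelta.
set L : R := (size (bx _ N))%:R; set S : R := (size (bx _ (4 * N)))%:R.
have LE : N%:R ^+ d <= L by rewrite /L size_bx natrX lerXn2r ?nnegrE// ler_nat leqW// leq_pmull.
have Nd0 : 0 < N%:R ^+ d :> R by rewrite exprn_gt0.
have L0 : 0 < L by exact: lt_le_trans LE.
have lnS : ln S <= B * (1 + ln N%:R).
  apply: (@le_trans _ _ (ln ((9 * N%:R) ^+ d))).
    rewrite ler_ln ?posrE; last 2 first.
    - by rewrite /S ltr0n size_bx expn_gt0.
    - by rewrite exprn_gt0// mulr_gt0.
    rewrite /S size_bx natrX lerXn2r ?nnegrE ?mulr_ge0//.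
    by rewrite mulnA; exact: (@ler_natS_mul 8 8).
  rewrite lnXn ?mulr_gt0// lnM ?posrE// -[leLHS]mulr_natl /B -[leRHS]mulrA ler_wpM2l//.
  by nra.
have Sge0 : 0 <= ln S by rewrite ln_ge0// /S ler1n size_bx expn_gt0.
set X : R := 1 + n%:R ^+ _ * alpha N.
have X1 : 1 <= X by rewrite lerDl mulr_ge0 ?exprn_ge0 ?alpha_ge0.
have X0 : 0 <= X by exact: le_trans ler01 X1.
set K := Ex _ _ _ _ => h.
have hK : K * ln S <= A * (N%:R / n%:R) ^+ d.-1 * X * (B * (1 + ln N%:R)).
  have K0 : 0 <= K.
    by apply: Ex_ge0 => // w; apply: sumr_ge0.
  by apply: ler_pM => //; exact: hA.
pose Y : R := (N%:R * n%:R ^+ d.-1)^-1.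
have Nn1 : 1 <= (N%:R / n%:R) ^+ d.-1 :> R.
  by rewrite exprn_ege1// ler_pdivlMr// mul1r ler_nat ltnW// (leq_ltn_trans _ nN)// leq_pmull.
have YE : (N%:R / n%:R) ^+ d.-1 = N%:R ^+ d * Y.
  rewrite /Y expr_div_n invfM mulrA; congr (_ / _).
  by rewrite -[in RHS](prednK d0) exprSr mulfK// gt_eqF.
have Y0 : 0 < Y by rewrite invr_gt0 mulr_gt0// exprn_gt0.
have T0 : 0 <= Y * X * (1 + ln N%:R).
  by rewrite mulr_ge0 ?addr_ge0// mulr_ge0// ltW.
have h1 : delta / (1 - p) * (L * alpha (8 * N)) <=
    L * ((A * B + 1) * (Y * X * (1 + ln N%:R)) + C * delta ^+ 2).
  apply: le_trans h _; rewrite [leRHS]mulrDr; apply: lerD; last first.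
    rewrite le_eqVlt; apply/orP; left; apply/eqP.
    by rewrite /C expr_div_n exprVn; ring.
  rewrite [X in L * X]mulrDl [leRHS]mulrDr; apply: lerD.
    apply: le_trans hK _; rewrite YE.
    rewrite [leLHS](_ : _ = N%:R ^+ d * (A * B * (Y * X * (1 + ln N%:R)))); last by ring.
    by rewrite ler_wpM2r// mulr_ge0// mulr_ge0// ltW.
  rewrite mul1r; apply: (@le_trans _ _ (N%:R ^+ d * (Y * X * (1 + ln N%:R)))).
    rewrite !mulrA -YE -[leLHS]mulr1 ler_pM//; first by rewrite -[leLHS]mulr1 ler_pM.
    by rewrite lerDl.
  by rewrite ler_wpM2r.
rewrite mulrCA ler_pM2l// in h1.
rewrite -/Y; set Z := Y * X * _ in h1.
have -> : delta^-1 * Y * X * (1 + ln N%:R) = Z / delta by rewrite /Z; ring.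
have Z0 : 0 <= Z := T0.
have h2 : alpha (8 * N) <= (1 - p) / delta * ((A * B + 1) * Z + C * delta ^+ 2).
  rewrite -(@ler_pM2l _ (delta / (1 - p))) ?divr_gt0// (le_trans h1)//.
  rewrite [leRHS]mulrA [X in _ <= X * _](_ : _ = 1) ?mul1r//.
  by field; rewrite !gt_eqF.
apply: le_trans h2 _; rewrite -[leRHS]mulrA -[leLHS]mulrA ler_pM2l//.
rewrite [leLHS](_ : _ = (A * B + 1) * (Z / delta) + C * delta); last by field; rewrite gt_eqF.
have Zd : 0 <= Z / delta by rewrite divr_ge0// ltW.
have AB : 0 < A * B by rewrite mulr_gt0.
set V := Z / delta in Zd *; nra.
Qed.

End Recursion.

(** * From the recursion to the exponent *)

Section Bootstrap.
Variables (R : realType) (d : nat) (a : nat -> R).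
Hypotheses (hd : (2 <= d)%N).
Implicit Types (n m N : nat) (g : R).

Definition decays g := exists C : R, forall m, (0 < m)%N -> a m <= C * m%:R `^ (- g).

(** This dominates the exponent [2 d ^ 2 + d] of the recursion, and it makes
    the fixed point [target] the exponent of the theorem. *)
Definition cost : nat := (2 * d ^ 2 + 3 * d - 3)%N.

Lemma cost_ge2 : (2 <= cost)%N.
Proof. by rewrite /cost -mulnn; have := leq_mul hd hd; lia. Qed.

Lemma cost_le : (2 * d ^ 2 + d <= cost)%N.
Proof. by rewrite /cost; lia. Qed.

(** The exponent obtained from the exponent [g], up to an arbitrarily small loss
    that pays for a logarithm. *)
Definition improved g : R := (1 + g * d.-1%:R / cost%:R) / 2.

Lemma powR_geR_ge1 N g : (0 < N)%N -> 0 <= g -> 1 <= N%:R `^ g :> R.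
Proof.
by move=> N0 g0; rewrite -[leLHS](powRr0 N%:R) ler_powR// ler1n.
Qed.

Lemma log_le_powR N e : (0 < N)%N -> 0 < e -> 1 + ln N%:R <= (1 + e^-1) * N%:R `^ e :> R.
Proof.
move=> N0 e0; have NR : 0 < N%:R :> R by rewrite ltr0n.
have p1 := powR_geR_ge1 N0 (ltW e0).
have pp : 0 < N%:R `^ e :> R by exact: powR_gt0.
have h : e * ln N%:R <= N%:R `^ e.
  rewrite -ln_powR; have := @le_ln1Dx R (N%:R `^ e - 1).
  by rewrite addrCA subrr addr0; lra.
rewrite mulrDl mul1r lerD//.
by rewrite mulrC ler_pdivlMr// mulrC.
Qed.

(** Choice of the inner radius: [n] is the integer part of [N^(g / cost)]. *)
Lemma inner_radius N g : (10 <= N)%N -> 0 <= g <= 1 -> exists n, [/\ (0 < n)%N,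
  (3 * n < N)%N, n%:R ^+ cost <= N%:R `^ g :> R &
  N%:R `^ (g / cost%:R) <= 2 * n%:R :> R].
Proof.
move=> N10 /andP[g0 g1]; have N0 : (0 < N)%N by exact: leq_trans N10.
have c0 : 0 < cost%:R :> R by rewrite ltr0n (leq_trans _ cost_ge2).
have gc0 : 0 <= g / cost%:R by rewrite divr_ge0// ltW.
set x : R := N%:R `^ (g / cost%:R).
have x1 : 1 <= x by exact: powR_geR_ge1.
have x0 : 0 <= x by exact: le_trans x1.
have /andP[n1 n2] := truncn_itv x0; set n := Num.truncn x in n1 n2.
have n0 : (0 < n)%N by rewrite truncn_gt0.
exists n; split => //.
- have : (n ^ 2 <= N)%N.
    rewrite -(ler_nat R) natrX; apply: (@le_trans _ _ (x ^+ 2)).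
      by rewrite lerXn2r ?nnegrE.
    rewrite -powR_mulrn// /x -powRrM -[leRHS]powRr1 ?ler0n//.
    apply: ler_powR; first by rewrite ler1n.
    rewrite mulrAC ler_pdivrMr// mul1r.
    by rewrite (@le_trans _ _ (1 * 2))// ?ler_wpM2r// mul1r ler_nat cost_ge2.
  by move: N10; clear; case: (leqP n 3); nia.
- apply: (@le_trans _ _ (x ^+ cost)); first by rewrite lerXn2r ?nnegrE.
  by rewrite -powR_mulrn// /x -powRrM divfK// gt_eqF.
- apply: le_trans (ltW n2) _; rewrite -natr1 mulr2n mulrDl mul1r lerD2l.
  by rewrite ler1n.
Qed.

Definition target : R := cost%:R / (2 * cost%:R - d.-1%:R).

Lemma target_den_gt0 : 0 < 2 * cost%:R - d.-1%:R :> R.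
Proof.
rewrite subr_gt0 -natrM ltr_nat.
by have := cost_le; rewrite -mulnn; have := leq_mul hd hd; lia.
Qed.

Lemma target_lt1 : target < 1.
Proof.
rewrite /target ltr_pdivrMr ?target_den_gt0// mul1r.
suff : d.-1%:R < cost%:R :> R by lra.
by rewrite ltr_nat; have := cost_le; rewrite -mulnn; have := leq_mul hd hd; lia.
Qed.

(** [target] is the fixed point of the affine contraction [improved]. *)
Lemma improved_target g :
  improved g - g = (1 - d.-1%:R / (2 * cost%:R)) * (target - g).
Proof.
have c0 : cost%:R != 0 :> R.
  by rewrite pnatr_eq0 -lt0n (leq_trans _ cost_ge2).
have t0 : 2 * cost%:R - d.-1%:R != 0 :> R by rewrite gt_eqF// target_den_gt0.
by rewrite /improved /target; field; rewrite c0 t0.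
Qed.

Hypotheses (a_ge0 : forall n, 0 <= a n) (a_le1 : forall n, a n <= 1).
Hypothesis a_anti : forall n m, (0 < n <= m)%N -> a m <= a n.
Variables (A kappa : R).
Hypotheses (A0 : 0 < A) (kappa0 : 0 < kappa).
Hypothesis rec : forall N n (delta : R), (0 < n)%N -> (3 * n < N)%N ->
  0 < delta -> delta <= kappa ->
  a (8 * N) <= A * (delta^-1 * (N%:R * n%:R ^+ d.-1)^-1 *
    (1 + n%:R ^+ (2 * d ^ 2 + d) * a N) * (1 + ln N%:R) + delta).

Lemma decays0 : decays 0.
Proof. by exists 1 => m _; rewrite oppr0 powRr0 mul1r. Qed.

Lemma decays_le g g' : g' <= g -> decays g -> decays g'.
Proof.
move=> gg [C hC]; exists C => m m0; have C0 : 0 <= C.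
  have := le_trans (a_ge0 1) (hC 1%N isT).
  by rewrite powR1 mulr1.
by apply: le_trans (hC m m0) _; rewrite ler_wpM2l// ler_powR ?lerN2// ler1n.
Qed.

(** The two terms of the recursion balance for [delta] of order
    [N ^ (- improved g)], since [2 * improved g = 1 + (d - 1) * (g / cost)]. *)
Lemma improved_bound g N C : 0 <= g <= 1 -> (10 <= N)%N -> 0 <= C ->
  a N <= C * N%:R `^ (- g) ->
  a (8 * N) <= A * (2 ^+ d.-1 / kappa * (1 + C) + kappa) *
    ((1 + ln N%:R) * N%:R `^ (- improved g)).
Proof.
move=> hg N10 C0 aN; have [n [n0 nN nc nx]] := inner_radius N10 hg.
have /andP[g0 g1] := hg.
have N0 : (0 < N)%N by exact: leq_trans N10.
have NR : 0 < N%:R :> R by rewrite ltr0n.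
have nR : 0 < n%:R :> R by rewrite ltr0n.
have n1 : 1 <= n%:R :> R by rewrite ler1n.
have c0 : 0 < cost%:R :> R by rewrite ltr0n (leq_trans _ cost_ge2).
have lnN : 0 <= ln N%:R :> R by rewrite ln_ge0// ler1n.
set f := improved g; have f0 : 0 <= f.
  by rewrite divr_ge0// addr_ge0// divr_ge0 ?mulr_ge0// ltW.
set y : R := N%:R `^ (- f).
have y0 : 0 < y by exact: powR_gt0.
have y1 : y <= 1 by rewrite /y powRN invf_le1 ?powR_gt0//; exact: powR_geR_ge1.
have d1 : kappa * y <= kappa by rewrite ler_piMr// ltW.
have d0 : 0 < kappa * y by rewrite mulr_gt0.
have X : 1 + n%:R ^+ (2 * d ^ 2 + d) * a N <= 1 + C.
  rewrite lerD2l; apply: (@le_trans _ _ (N%:R `^ g * (C * N%:R `^ (- g)))).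
    apply: ler_pM => //.
    by apply: le_trans nc; rewrite ler_weXn2l// cost_le.
  by rewrite powRN mulrCA mulfV ?mulr1// gt_eqF// powR_gt0.
have Y : (N%:R * n%:R ^+ d.-1)^-1 <= 2 ^+ d.-1 * y ^+ 2.
  rewrite -[leRHS]invrK lef_pV2 ?posrE ?invr_gt0 ?mulr_gt0 ?exprn_gt0//.
  rewrite invfM /y powRN exprVn invrK -(powR_mulrn 2 (powR_ge0 _ f)) -powRrM.
  have -> : f * 2 = 1 + (g / cost%:R) * d.-1%:R.
    by rewrite /f /improved divfK ?pnatr_eq0//; congr (_ + _); rewrite mulrAC.
  rewrite powRD; last by apply/implyP => _; rewrite gt_eqF.
  rewrite powRr1 ?ler0n// mulrCA ler_wpM2l ?ler0n// powRrM powR_mulrn ?powR_ge0//.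
  rewrite [leLHS]mulrC ler_pdivrMr ?exprn_gt0// -exprMn.
  by rewrite lerXn2r ?nnegrE ?powR_ge0 ?mulr_ge0// [leRHS]mulrC.
apply: le_trans (rec n0 nN d0 d1) _.
rewrite -[leRHS]mulrA ler_pM2l//.
have L0 : 0 <= 1 + ln N%:R :> R by rewrite addr_ge0.
rewrite mulrDl; apply: lerD; last first.
  by rewrite ler_wpM2l ?(ltW kappa0)// ler_peMl ?(ltW y0)// lerDl.
rewrite [leRHS](_ : _ =
    (kappa * y)^-1 * (2 ^+ d.-1 * y ^+ 2) * (1 + C) * (1 + ln N%:R)); last first.
  by field; rewrite !gt_eqF.
rewrite ler_wpM2r//; apply: ler_pM => //.
- by rewrite mulr_ge0 ?invr_ge0 ?mulr_ge0 ?exprn_ge0 ?ler0n ?(ltW kappa0) ?(ltW y0).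
- by rewrite addr_ge0// mulr_ge0// exprn_ge0.
- by rewrite ler_wpM2l// invr_ge0 ltW.
Qed.

(** The recursion controls the multiples of 8 from 80 on; the values in between
    are reached by monotonicity, as [m <= 16 * (m %/ 8)]. *)
Lemma decays_improved g e : 0 <= g <= 1 -> 0 < e -> 0 <= improved g - e ->
  decays g -> decays (improved g - e).
Proof.
move=> hg e0 h0 [C0 hC0]; set h := improved g - e in h0 *.
have C0_ge0 : 0 <= C0.
  by have := le_trans (a_ge0 1) (hC0 1%N isT); rewrite powR1 mulr1.
set B : R := A * (2 ^+ d.-1 / kappa * (1 + C0) + kappa) * (1 + e^-1).
have Q0 : 0 <= 2 ^+ d.-1 / kappa * (1 + C0) + kappa.
  have k0 := ltW kappa0.
  by rewrite addr_ge0// mulr_ge0 ?addr_ge0// divr_ge0 ?exprn_ge0.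
have B0 : 0 <= B.
  by rewrite mulr_ge0 ?addr_ge0 ?invr_ge0 ?(ltW e0)// mulr_ge0// ltW.
exists (B * 16 `^ h + 80 `^ h) => m m0.
have mR : 0 < m%:R :> R by rewrite ltr0n.
have scale (k : nat) : (0 < k)%N -> (k%:R : R) `^ h * m%:R `^ (- h) = (k%:R / m%:R) `^ h.
  move=> k0; rewrite powRM ?invr_ge0 ?ler0n//; congr (_ * _).
  by rewrite -powR_inv1 ?ler0n// -powRrM mulN1r.
have [m80|m80] := ltnP m 80.
  apply: le_trans (a_le1 m) _; rewrite mulrDl (scale 80%N)// -[leLHS]add0r lerD//.
    by rewrite mulr_ge0 ?powR_ge0// mulr_ge0 ?powR_ge0.
  rewrite -[leLHS](powRr0 (80%:R / m%:R)) ler_powR//.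
  by rewrite ler_pdivlMr// mul1r ler_nat ltnW.
set N := (m %/ 8)%N.
have N10 : (10 <= N)%N by rewrite leq_divRL.
have N0 : (0 < N)%N by exact: leq_trans N10.
have Nm : (8 * N <= m)%N by rewrite mulnC leq_trunc_div.
have mN : (m <= 16 * N)%N.
  by have := ltn_ceil m (isT : (0 < 8)%N); rewrite -/N; move: N0; clear; lia.
have NR : 0 < N%:R :> R by rewrite ltr0n.
apply: (@le_trans _ _ (a (8 * N))); first by apply: a_anti; rewrite Nm muln_gt0 N0.
apply: le_trans (improved_bound hg N10 C0_ge0 (hC0 N N0)) _.
apply: (@le_trans _ _ (B * N%:R `^ (- h))).
  have -> : N%:R `^ (- h) = N%:R `^ e * N%:R `^ (- improved g) :> R.
    rewrite -powRD; last by apply/implyP => _; rewrite gt_eqF.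
    by congr (_ `^ _); rewrite /h opprB.
  rewrite /B -[leRHS]mulrA ler_wpM2l ?mulr_ge0 ?(ltW A0)//.
  by rewrite mulrA ler_wpM2r ?powR_ge0// log_le_powR.
rewrite mulrDl -[leLHS]addr0; apply: lerD; last by rewrite mulr_ge0 ?powR_ge0.
rewrite -mulrA ler_wpM2l// (scale 16%N)// powRN -powR_inv1 ?powR_ge0//.
rewrite -powRrM mulrC powRrM powR_inv1 ?ler0n//.
apply: ge0_ler_powR => //; rewrite ?nnegrE ?divr_ge0 ?invr_ge0 ?ler0n//.
rewrite ler_pdivlMr// mulrC ler_pdivrMr//.
by rewrite -natrM ler_nat.
Qed.

(** Below [g < target] each application of [improved] gains at least [2 eta]; one
    [eta] is given up for the logarithm, so finitely many steps reach [g]. *)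
Lemma decays_target g : 0 <= g -> g < target -> decays g.
Proof.
move=> g0 gt; have c0 : 0 < cost%:R :> R by rewrite ltr0n (leq_trans _ cost_ge2).
pose c : R := 1 - d.-1%:R / (2 * cost%:R).
have cpos : 0 < c.
  rewrite subr_gt0 ltr_pdivrMr ?mulr_gt0// mul1r.
  by have := target_den_gt0; lra.
pose eta := c * (target - g) / 2.
have eta0 : 0 < eta by rewrite divr_gt0// mulr_gt0// subr_gt0.
suff step k : decays (Num.min (k%:R * eta) g).
  have [k hk] : exists k : nat, g <= k%:R * eta.
    exists (Num.truncn (g / eta)).+1; rewrite -ler_pdivrMr//.
    by have /andP[_ /ltW] := truncn_itv (divr_ge0 g0 (ltW eta0)).
  by have := step k; rewrite (min_idPr hk).
elim: k => [|k IH]; first by rewrite mul0r (min_idPl g0); exact: decays0.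
set gk := Num.min _ g in IH.
have gk0 : 0 <= gk by rewrite le_min g0 mulr_ge0// ltW.
have gkg : gk <= g by rewrite ge_min lexx orbT.
have gk1 : gk <= 1 by rewrite (le_trans gkg)// ltW// (lt_trans gt target_lt1).
have imp : gk + eta <= improved gk - eta.
  have := improved_target gk; rewrite -/c.
  have : c * (target - g) <= c * (target - gk) by rewrite ler_pM2l// lerB.
  have : c * (target - g) = 2 * eta by rewrite /eta; field.
  by lra.
apply: decays_le (decays_improved _ eta0 _ IH); [|by rewrite gk0|]; last first.
  by apply: le_trans imp; rewrite addr_ge0// ltW.
apply: le_trans imp; rewrite /gk -natr1 mulrDl mul1r.
have [h|h] := leP (k%:R * eta) g.
  by rewrite ge_min lexx.
by rewrite ge_min; apply/orP; right; rewrite lerDl ltW.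
Qed.

End Bootstrap.

Section Limsup.
Variables (R : realType) (a : nat -> R).

Lemma limsup_le_exponent (t : R) : 0 < t -> (forall n, 0 <= a n) ->
  (forall g, 0 <= g -> g < t -> decays a g) ->
  (limn_esup (fun n : nat => (1 / ln (n%:R : R))%R%:E * lne (a n)%:E) <= (- t)%R%:E)%E.
Proof.
move=> t0 a0 ha; apply/lee_addgt0Pr => e e0.
pose g := Num.max 0 (t - e / 2).
have g0 : 0 <= g by rewrite le_max lexx.
have gt : g < t by rewrite gt_max t0 /= ltrBlDr ltrDl divr_gt0.
have ge : t - e / 2 <= g by rewrite le_max lexx orbT.
have [C hC] := ha g g0 gt.
(* enlarging [C] makes its logarithm nonnegative *)
pose B := Num.max 1 C; have B1 : 1 <= B by rewrite le_max lexx.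
have lnB : 0 <= ln B by rewrite ln_ge0.
(* beyond [n0] the constant [B] costs at most [e / 2] in the exponent *)
pose n0 := (Num.truncn (expR (2 * ln B / e))).+2.
apply: ereal_inf_le.
exists (ereal_sup [set (1 / ln (n%:R : R))%R%:E * lne (a n)%:E | n in [set n | (n0 <= n)%N]])%E.
  by exists [set n | (n0 <= n)%N] => //; exists n0.
apply: ge_ereal_sup => _ [n nn0 <-]; rewrite /= in nn0.
have n2 : (2 <= n)%N by exact: leq_trans nn0.
have nR : 1 < n%:R :> R by rewrite ltr1n.
have ln0 : 0 < ln n%:R :> R by rewrite ln_gt0.
have [an|an] := leP (a n) 0.
  by rewrite le0_lneNy ?lee_fin// gt0_muleNy ?leNye// lte_fin divr_gt0.
rewrite lne_EFin// -EFinM -EFinD lee_fin mul1r mulrC ler_pdivrMr//.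
have nB : ln (a n) <= ln B - g * ln n%:R.
  have Bpos : 0 < B := lt_le_trans ltr01 B1.
  have npos : 0 < n%:R `^ (- g) :> R by rewrite powR_gt0// (lt_trans ltr01 nR).
  rewrite -mulNr -ln_powR -lnM ?posrE// ler_ln ?posrE ?mulr_gt0//.
  apply: le_trans (hC n (ltnW n2)) _.
  by rewrite ler_wpM2r ?powR_ge0// le_max lexx orbT.
have hB : ln B <= e / 2 * ln n%:R.
  have : 2 * ln B / e <= ln n%:R.
    rewrite -[leLHS]expRK ler_ln ?posrE ?expR_gt0 ?(lt_trans ltr01 nR)//.
    apply: le_trans (_ : n0%:R <= _); last by rewrite ler_nat.
    have /andP[_ /ltW h] := truncn_itv (expR_ge0 (2 * ln B / e)).
    by apply: le_trans h _; rewrite ler_nat.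
  by rewrite ler_pdivrMr//; lra.
apply: le_trans nB _.
have : (t - e / 2) * ln n%:R <= g * ln n%:R by rewrite ler_wpM2r// ltW.
by move: hB; lra.
Qed.

End Limsup.

(** * The two-arms exponent *)

Section CriticalPoint.
Variables (R : realType) (d : nat) (hd : (2 <= d)%N).
Variables (P : R -> probability (configurations d) R) (hP : site_percolation P).

Lemma Pr_closed (p : R) s (x : site d) : uniq s -> x \in s ->
  Pr p s (fun w => w x = false) = 1 - p.
Proof.
move=> us xs; rewrite [LHS](@Pr_marginal R d p [:: x] s (fun w => w x = false)
  (fun=> false))//=; last 2 first.
- by move=> y; rewrite inE => /eqP ->.
- by move=> w w' ww'; rewrite ww'// mem_head.
rewrite /Pr /= !upd_same asboolF// asboolT//.
by rewrite mulr0 add0r mulr1.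
Qed.

(** At density 0 no neighbour of the origin is open, at density 1 the origin is
    not closed. *)
Lemma alpha_endpoint (p : R) n : p = 0 \/ p = 1 -> (0 < n)%N -> alpha d p n = 0.
Proof.
move=> hp01 n0; have hp : 0 <= p <= 1.
  by case: hp01 => ->; rewrite lexx ler01.
apply/eqP; rewrite eq_le Pr_ge0// andbT.
case: hp01 => p01.
  have sub y : y \in nbrs (0 : site d) -> y \in bx 0 n.
    by rewrite (mem_nbrs R) => yb; apply/mem_bx; exact: neighbor_box yb n0.
  apply: (@le_trans _ _ (\sum_(y <- nbrs (0 : site d)) Pr p (bx 0 n) (fun w => w y))).
    apply: Pr_le_sum => // w /two_armsP[y [z [a [b [[xy _] _ [ya _] _]]]]].
    by exists y; [rewrite (mem_nbrs R)|case: (connected_openl ya)].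
  rewrite big_seq big1// => y /sub yb.
  by rewrite Pr_open ?bx_uniq.
apply: (@le_trans _ _ (Pr p (bx 0 n) (fun w => w (0 : site d) = false))).
  by apply: le_Pr => // w; exact: two_arms_closed.
rewrite Pr_closed ?bx_uniq//; first by rewrite p01 subrr.
exact/mem_bx/box_center.
Qed.

Lemma critical_decays g : 0 <= g -> g < target R d ->
  decays (alpha d (critical_probability P)) g.
Proof.
move=> g0 gt; set pc := critical_probability P.
have /andP[pc0 pc1] : 0 <= pc <= 1 by exact: critical_probability_itv.
have endpoint : pc = 0 \/ pc = 1 -> decays (alpha d pc) g.
  by move=> h; exists 0 => m m0; rewrite alpha_endpoint// mul0r.
have [e0|n0] := eqVneq pc 0; first by apply: endpoint; left.
have [e1|n1] := eqVneq pc 1; first by apply: endpoint; right.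
have p0 : 0 < pc by rewrite lt_neqAle eq_sym n0.
have p1 : pc < 1 by rewrite lt_neqAle n1.
have d0 : (0 < d)%N by exact: ltnW.
have crit n : 1 <= Phi d pc n by exact: critical_Phi.
have [A A0 hA] := alpha_recursion p0 p1 d0 crit.
have k0 : 0 < pc * (1 - pc) / 2 by rewrite divr_gt0// mulr_gt0// subr_gt0.
apply: (decays_target hd _ _ _ A0 k0 hA) => //.
- by move=> n; exact: alpha_ge0.
- by move=> n; exact: alpha_le1.
- by move=> n m nm; exact: alpha_anti.
Qed.

Lemma targetE :
  target R d = (2 * d%:R ^+ 2 + 3 * d%:R - 3) / (4 * d%:R ^+ 2 + 5 * d%:R - 5).
Proof.
have c : (cost d)%:R = 2 * d%:R ^+ 2 + 3 * d%:R - 3 :> R.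
  rewrite /cost natrB; first by rewrite natrD !natrM expr2.
  by rewrite -mulnn; move: hd; clear; nia.
rewrite /target c -subn1 natrB ?(ltnW hd)//; congr (_ / _); ring.
Qed.

End CriticalPoint.

Theorem theorem1p1 (R : realType) (d : nat) (hd : (2 <= d)%N)
    (P : R -> probability (configurations d) R) (hP : site_percolation P) :
  (limn_esup (fun n : nat =>
     (1 / ln (n%:R : R))%R%:E *
     lne (P (critical_probability P) (two_arms R (0%R : site d) n)))
   <= (- ((2 * d%:R ^+ 2 + 3 * d%:R - 3) /
          (4 * d%:R ^+ 2 + 5 * d%:R - 5)))%R%:E)%E.
Proof.
have hpc := critical_probability_itv P.
have -> : (fun n : nat => (1 / ln (n%:R : R))%R%:E *
     lne (P (critical_probability P) (two_arms R (0%R : site d) n)))%E =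
   (fun n : nat => (1 / ln (n%:R : R))%R%:E * lne (alpha d (critical_probability P) n)%:E)%E.
  apply/funext => n; congr (_ * lne _)%E.
  have dep := depends_on_bx (@two_arms_depends R d 0%R n).
  have [_ h] := percolation_Pr hP hpc (bx_uniq _ _) dep.
  exact: h.
rewrite -(targetE R hd); apply: limsup_le_exponent.
- apply: divr_gt0; last exact: target_den_gt0.
  by rewrite ltr0n (leq_trans _ (cost_ge2 hd)).
- by move=> n; exact: Pr_ge0.
- by move=> g; exact: critical_decays.
Qed.
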